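(* Every $D(4)$-quadruple $\{a,b,c,d\}$ in $\mathbb{Z}[i][X]$ is regular, i.e. satisfies $$(a+b-c-d)^2=(ab+4)(cd+4).$$
   Context: A $D(4)$-quadruple in $\mathbb{Z}[i][X]$ is a set $\{a,b,c,d\}$ of four distinct non-zero polynomials in $\mathbb{Z}[i][X]$, not all of them constant, such that the product of any two distinct elements increased by $4$ is the square of a polynomial in $\mathbb{Z}[i][X]$. A $D(4)$-quadruple $\{a,b,c,d\}$ in $\mathbb{Z}[i][X]$ is called regular if $(a+b-c-d)^2=(ab+4)(cd+4)$. Equivalently, if $ab+4=r^2$, $ac+4=s^2$, $bc+4=t^2$ with $r,s,t\in\mathbb{Z}[i][X]$, it is regular if $d=a+b+c+\frac12(abc\pm rst)$ for one of the two choices of sign. *)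

(* Defs.v *)
From HB Require Import structures.
From mathcomp Require Import all_boot all_order all_algebra all_field.

Set Implicit Arguments.
Unset Strict Implicit.
Unset Printing Implicit Defensive.

Import Order.TTheory GRing.Theory Num.Theory.

Local Open Scope ring_scope.

(* The ring Z[i], as the subring of the complex algebraic numbers with integer
   real and imaginary parts. *)
Definition gaussInteger_pred : {pred algC} :=
  fun x => ('Re x \in Num.int) && ('Im x \in Num.int).
Definition gaussInteger : qualifier 1 algC :=
  [qualify a x : algC | gaussInteger_pred x].

Fact gaussInteger_subring : subring_closed gaussInteger.
Proof.
split=> [|x y /andP[xr xi] /andP[yr yi]|x y /andP[xr xi] /andP[yr yi]].
- by rewrite qualifE /= /gaussInteger_pred (Creal_ReP _ _) ?(Creal_ImP _ _) ?rpred0 ?rpred1.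
- by rewrite qualifE /= /gaussInteger_pred !raddfB /= !rpredB.
rewrite qualifE /= /gaussInteger_pred [x]Crect [y]Crect mulC_rect.
by rewrite Re_rect ?Im_rect ?rpredB ?rpredD ?rpredM ?Creal_Re ?Creal_Im.
Qed.

HB.instance Definition _ :=
  GRing.isSubringClosed.Build algC gaussInteger_pred gaussInteger_subring.

Record gaussInt := GaussInt {
  gval :> algC;
  gvalP : gval \is a gaussInteger
}.

HB.instance Definition _ := [isSub for gval].
HB.instance Definition _ := [Choice of gaussInt by <:].
HB.instance Definition _ := [SubChoice_isSubComNzRing of gaussInt by <:].

Definition is_square (R : nzRingType) (x : R) : Prop := exists r : R, x = r ^+ 2.

(* A polynomial p is constant iff size p <= 1. *)
Definition D4_quadruple (a b c d : {poly gaussInt}) : Prop :=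
  let s := [:: a; b; c; d] in
  [/\ uniq s,
      0 \notin s,
      ~~ all (fun p : {poly gaussInt} => (size p <= 1)%N) s
    & {in s &, forall p q, p != q -> is_square (p * q + 4)}].

Definition regular_quadruple (a b c d : {poly gaussInt}) : Prop :=
  (a + b - c - d) ^+ 2 = (a * b + 4) * (c * d + 4).

(* Main.v *)
(* Let the degrees satisfy deg a <= deg b <= deg c <= deg d, and normalise 4 to 1. An
   extension d of the pair {a, c} corresponds to a solution of a z^2 - c x^2 = a - c, on
   which the unit s + sqrt(a c), s^2 = a c + 1, acts; d is thus the n-th term of a chain
   starting at some D of small degree, and
     d = a n^2 + 2 n s X Z + D mod c,  where X^2 = a D + 1 and Z^2 = c D + 1.
   The pair {b, c} gives a second such expression. If deg b < deg c, comparing z mod c and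
   using induction on deg d, the starting points are among 0, a, b and the small regular
   extension e of {a, b, c}. Then both expressions have degree less than deg c, hence are
   equal, and comparison of degrees leaves only the regular d. If deg b = deg c, then
   c = a + b + 2 r with r^2 = a b + 1, or a^2 = -1 and c = 2 a - b; the second congruence
   becomes explicit in a and s, and counting the steps of the two chains concludes. *)

Require Import Defs.
From mathcomp Require Import all_boot all_order all_algebra all_field.
From mathcomp Require Import ring zify.

Set Implicit Arguments.
Unset Strict Implicit.
Unset Printing Implicit Defensive.

Import Order.TTheory GRing.Theory Num.Theory.

Local Open Scope ring_scope.

(** A congruence modulo [c] between polynomials of degree below [deg c] is an equality, and
    comparison of degrees in it leaves equations between the integer positions in the two chains.
    Three obstacles shape the proof. Signs of roots are unknown: they are absorbed into the
    positions, which become signed integers, and the regular [d] shows up as a solution such as -2.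
    Parity matters: modulo [c] the root [z] is that of the starting point after an even number of
    steps and [s] times it after an odd number, so the starting points of two chains can be compared
    only once the parities are under control. Constants escape every degree argument: the arithmetic
    of Z[i] reduces them to the single exception [a ^+ 2 = -1], in which [a] extends the pair {a, c}
    by itself with root 0; this exception runs through all cases as a separate branch. Coefficients
    are taken in [algC] so that constants have square roots. *)

Local Notation P := {poly algC}.

(** * Degrees and congruences *)

(** The zero polynomial gets degree 0: additivity of degrees needs nonzero factors, while a positive
    degree alone certifies that a polynomial is nonzero. *)
Definition deg (p : P) : nat := (size p).-1.

Ltac arith_type T := first [unify T nat | unify T int].
Ltac arith_only :=
  repeat match goal with
  | H : ?T |- _ =>
    lazymatch type of T with
    | Prop =>
      lazymatch T with
      | is_true (leq _ _) => fail
      | is_true (leq _ _ && leq _ _) => fail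
      | is_true (@Order.le _ _ _ _) => fail
      | is_true (@Order.lt _ _ _ _) => fail
      | @eq ?U _ _ => tryif arith_type U then fail else clear H
      | ~ (@eq ?U _ _) => tryif arith_type U then fail else clear H
      | @eq ?U _ _ -> False => tryif arith_type U then fail else clear H
      | (@eq ?U _ _) \/ _ => tryif arith_type U then fail else clear H
      | _ => clear H
      end
    end
  end.
Ltac dlia := solve [arith_only; lia].

Lemma degD_le (p q : P) m n :
  (deg p <= m)%N -> (deg q <= n)%N -> (deg (p + q) <= maxn m n)%N.
Proof. by rewrite /deg => hp hq; have := size_polyD p q; dlia. Qed.

Lemma degN (p : P) : deg (- p) = deg p.
Proof. by rewrite /deg size_polyN. Qed.

Lemma degN_le (p : P) n : (deg p <= n)%N -> (deg (- p) <= n)%N.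
Proof. by rewrite degN. Qed.

Lemma degM_le (p q : P) m n :
  (deg p <= m)%N -> (deg q <= n)%N -> (deg (p * q) <= m + n)%N.
Proof. by rewrite /deg => hp hq; have := size_polyMleq p q; dlia. Qed.

Lemma degX_le (p : P) n k : (deg p <= n)%N -> (deg (p ^+ k) <= k * n)%N.
Proof.
move=> hp; elim: k => [|k IH]; first by rewrite expr0 /deg size_poly1.
by rewrite exprS; apply: leq_trans (degM_le hp IH) _; rewrite mulSn.
Qed.

Lemma deg0 : deg 0 = 0%N.
Proof. by rewrite /deg size_poly0. Qed.

Lemma deg1 : deg 1 = 0%N.
Proof. by rewrite /deg size_poly1. Qed.

Lemma degC (x : algC) : deg x%:P = 0%N.
Proof. by rewrite /deg size_polyC; case: (x != 0). Qed.

Lemma degZ_int (M : int) : deg M%:~R = 0%N.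
Proof. by rewrite -(rmorph_int (@polyC algC)) degC. Qed.

Lemma degZ_nat (n : nat) : deg n%:R = 0%N.
Proof. by rewrite -(rmorph_nat (@polyC algC)) degC. Qed.

Ltac deg_bound :=
  lazymatch goal with
  | |- is_true (deg (_ + _) <= _)%N => eapply degD_le; deg_bound
  | |- is_true (deg (- _) <= _)%N => eapply degN_le; deg_bound
  | |- is_true (deg (_ * _) <= _)%N => eapply degM_le; deg_bound
  | |- is_true (deg (_ ^+ _) <= _)%N => eapply degX_le; deg_bound
  | |- is_true (deg 0 <= _)%N => rewrite deg0; apply: (leqnn 0)
  | |- is_true (deg 1 <= _)%N => rewrite deg1; apply: (leqnn 0)
  | |- is_true (deg (_ %:~R) <= _)%N => rewrite degZ_int; apply: (leqnn 0)
  | |- is_true (deg (_ %:R) <= _)%N => rewrite degZ_nat; apply: (leqnn 0)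
  | |- is_true (deg (_ %:P) <= _)%N => rewrite degC; apply: (leqnn 0)
  | |- _ => apply: leqnn
  end.

Ltac deg_tac :=
  lazymatch goal with
  | |- is_true (deg _ < _)%N => eapply leq_ltn_trans; [deg_bound | dlia]
  | |- is_true (deg _ <= _)%N => eapply leq_trans; [deg_bound | dlia]
  end.

Lemma degM (p q : P) : p != 0 -> q != 0 -> deg (p * q) = (deg p + deg q)%N.
Proof.
rewrite -!size_poly_eq0 /deg => hp hq.
rewrite size_mul -?size_poly_eq0 //; move: hp hq.
by case: (size p) => [|m]; case: (size q) => [|n] //= _ _; rewrite addnS.
Qed.

Lemma deg_sqr (p : P) : deg (p ^+ 2) = (2 * deg p)%N.
Proof.
have [->|hp] := eqVneq p 0; first by rewrite expr0n deg0.
by rewrite expr2 degM // mul2n -addnn.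
Qed.

Lemma deg_gt0_neq0 (p : P) : (0 < deg p)%N -> p != 0.
Proof. by case: eqVneq => // ->; rewrite deg0. Qed.

Lemma degDl (p q : P) : (deg q < deg p)%N -> deg (p + q) = deg p.
Proof. by rewrite /deg => h; rewrite size_polyDl //; dlia. Qed.

Lemma degDr (p q : P) : (deg p < deg q)%N -> deg (p + q) = deg q.
Proof. by move=> h; rewrite addrC degDl. Qed.

Lemma intP_eq0 (M : int) : (M%:~R == 0 :> P) = (M == 0).
Proof. by rewrite -(rmorph_int (@polyC algC)) polyC_eq0 intr_eq0. Qed.

Lemma natP_eq0 (n : nat) : (n%:R == 0 :> P) = (n == 0%N).
Proof. by rewrite -(rmorph_nat (@polyC algC)) polyC_eq0 pnatr_eq0. Qed.

Lemma deg_intM (M : int) (p : P) : M != 0 -> deg (M%:~R * p) = deg p.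
Proof.
move=> hM; have [->|hp] := eqVneq p 0; first by rewrite mulr0.
by rewrite degM ?intP_eq0 // degZ_int.
Qed.

Lemma deg_natM (n : nat) (p : P) : n != 0%N -> deg (n%:R * p) = deg p.
Proof.
move=> hM; have [->|hp] := eqVneq p 0; first by rewrite mulr0.
by rewrite degM ?natP_eq0 // degZ_nat.
Qed.

Lemma deg_eq0P (p : P) : deg p = 0%N -> exists x, p = x%:P.
Proof.
by move=> h; exists p`_0; apply: size1_polyC; move: h; rewrite /deg; dlia.
Qed.

(** The usual way to extract an integer equation from a polynomial identity: a dominant term can
    only carry the coefficient 0. *)
Lemma mul_int_deg_eq0 (M : int) (p q : P) :
  M%:~R * p = q -> (deg q < deg p)%N -> M = 0.
Proof.
move=> E; have [//|hM] := eqVneq M 0.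
by rewrite -E deg_intM // ltnn.
Qed.

Lemma mul_deg_eq0 (u p q : P) : p * u = q -> (deg q < deg p)%N -> u = 0.
Proof.
move=> E h; have [//|hu] := eqVneq u 0.
have hp : p != 0 by apply: deg_gt0_neq0; dlia.
by move: h; rewrite -E degM //; dlia.
Qed.

Lemma mul_const (p q : P) : p * q != 0 -> deg (p * q) = 0%N ->
  deg p = 0%N /\ deg q = 0%N.
Proof.
rewrite mulf_eq0 negb_or => /andP[hp hq]; rewrite degM //; dlia.
Qed.

Lemma sqrf_eq (p q : P) : p ^+ 2 = q ^+ 2 -> p = q \/ p = - q.
Proof.
by move/eqP; rewrite eqf_sqr => /orP[] /eqP ->; [left|right].
Qed.

Definition congr (c p q : P) := exists k, p = q + c * k.

Lemma congr_refl c p : congr c p p.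
Proof. by exists 0; rewrite mulr0 addr0. Qed.
Lemma congr_sym c p q : congr c p q -> congr c q p.
Proof. by case=> k ->; exists (- k); ring. Qed.
Lemma congr_trans c q p r : congr c p q -> congr c q r -> congr c p r.
Proof. by case=> k -> [l ->]; exists (k + l); ring. Qed.
Lemma congrN c p q : congr c p q -> congr c (- p) (- q).
Proof. by case=> k ->; exists (- k); ring. Qed.
Lemma congrM c p q p' q' : congr c p q -> congr c p' q' -> congr c (p * p') (q * q').
Proof. by case=> k -> [l ->]; exists (k * q' + q * l + c * k * l); ring. Qed.

Lemma congr_eq c p q :
  (deg p < deg c)%N -> (deg q < deg c)%N -> congr c p q -> p = q.
Proof.
move=> hp hq [k E]; have E' : c * k = p - q by rewrite E; ring.
have: k = 0 by apply: (mul_deg_eq0 E'); deg_tac.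
by rewrite E => ->; rewrite mulr0 addr0.
Qed.

(** * Gaussian integers *)

Lemma gaussIntegerP (z : algC) :
  reflect (exists x y : int, z = x%:~R + 'i * y%:~R) (z \is a gaussInteger).
Proof.
apply: (iffP idP) => [|[x [y ->]]].
  rewrite qualifE /= => /andP[/intrP[x hx] /intrP[y hy]].
  by exists x, y; rewrite [z]Crect hx hy.
by rewrite qualifE /= /gaussInteger_pred Re_rect ?Im_rect ?Rreal_int ?intr_int.
Qed.

Lemma rect_int_inj (x y u v : int) :
  x%:~R + 'i * y%:~R = u%:~R + 'i * v%:~R :> algC -> x = u /\ y = v.
Proof.
move=> E; have := congr1 (fun z => ('Re z, 'Im z)) E.
by rewrite /= !Re_rect ?Im_rect ?Rreal_int // => -[/intr_inj -> /intr_inj ->].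
Qed.

(* With pi = 1 + i, one has 2 = - i pi ^ 2; f = g mod pi forces f = g mod pi ^ 2. *)
Lemma gaussInteger_half (f g h : algC) :
  f \is a gaussInteger -> g \is a gaussInteger -> h \is a gaussInteger ->
  f ^+ 2 - g ^+ 2 = 4 * h -> (f - g) / 2 \is a gaussInteger.
Proof.
move=> /gaussIntegerP[a [b ->]] /gaussIntegerP[c [d ->]] /gaussIntegerP[u [v ->]].
have i2 : 'i ^+ 2 = -1 :> algC by rewrite sqrCi.
move=> E; have {E} /rect_int_inj[E1 E2] :
    (a * a - b * b - c * c + d * d)%:~R + 'i * (2 * (a * b - c * d))%:~R =
    (4 * u)%:~R + 'i * (4 * v)%:~R :> algC.

  have -> : (4 * u)%:~R + 'i * (4 * v)%:~R = 4 * (u%:~R + 'i * v%:~R) :> algC by ring.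
  by rewrite -E; ring: i2.
(* The two equations modulo 4 are tested against the sixteen parity patterns of [a], [b], [c],
   [d]. *)
have [x [y [Hx Hy]]] : exists x y, a - c = 2 * x /\ b - d = 2 * y.
  have ha := divz_eq a 2; have hb := divz_eq b 2.
  have hc := divz_eq c 2; have hd := divz_eq d 2.
  exists (divz a 2 - divz c 2), (divz b 2 - divz d 2).
  have la := modz_ge0 a (isT : 2 != 0 :> int); have la' := ltz_pmod a (isT : 0 < 2 :> int).
  have lb := modz_ge0 b (isT : 2 != 0 :> int); have lb' := ltz_pmod b (isT : 0 < 2 :> int).
  have lc := modz_ge0 c (isT : 2 != 0 :> int); have lc' := ltz_pmod c (isT : 0 < 2 :> int).
  have ld := modz_ge0 d (isT : 2 != 0 :> int); have ld' := ltz_pmod d (isT : 0 < 2 :> int).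
  move: (a %/ 2)%Z (b %/ 2)%Z (c %/ 2)%Z (d %/ 2)%Z (a %% 2)%Z (b %% 2)%Z (c %% 2)%Z (d %% 2)%Z
    ha hb hc hd la la' lb lb' lc lc' ld ld'
    => a1 b1 c1 d1 a0 b0 c0 d0 ha hb hc hd la la' lb lb' lc lc' ld ld'.
  move: E1 E2; rewrite ha hb hc hd => {ha hb hc hd a b c d}.
  have [->|->] : a0 = 0 \/ a0 = 1 by lia.
  - have [->|->] : b0 = 0 \/ b0 = 1 by lia.
    + have [->|->] : c0 = 0 \/ c0 = 1 by lia.
      * by have [->|->] : d0 = 0 \/ d0 = 1 by [lia|]; lia.
      * by have [->|->] : d0 = 0 \/ d0 = 1 by [lia|]; lia.
    + have [->|->] : c0 = 0 \/ c0 = 1 by lia.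
      * by have [->|->] : d0 = 0 \/ d0 = 1 by [lia|]; lia.
      * by have [->|->] : d0 = 0 \/ d0 = 1 by [lia|]; lia.
  - have [->|->] : b0 = 0 \/ b0 = 1 by lia.
    + have [->|->] : c0 = 0 \/ c0 = 1 by lia.
      * by have [->|->] : d0 = 0 \/ d0 = 1 by [lia|]; lia.
      * by have [->|->] : d0 = 0 \/ d0 = 1 by [lia|]; lia.
    + have [->|->] : c0 = 0 \/ c0 = 1 by lia.
      * by have [->|->] : d0 = 0 \/ d0 = 1 by [lia|]; lia.
      * by have [->|->] : d0 = 0 \/ d0 = 1 by [lia|]; lia.
apply/gaussIntegerP; exists x, y.
have -> : (a%:~R + 'i * b%:~R - (c%:~R + 'i * d%:~R)) =
   (a - c)%:~R + 'i * (b - d)%:~R :> algC by ring.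
by rewrite Hx Hy; field.
Qed.

Lemma int_mul_eq1 (m n : int) : m * n = 1 -> 0 <= m -> 0 <= n -> m = 1.
Proof.
move=> E hm hn; have [m0|[//|m2]] : m = 0 \/ m = 1 \/ 2 <= m by lia.
  by move: E; rewrite m0 mul0r.
have [n0|n1] : n = 0 \/ 1 <= n by lia.
  by move: E; rewrite n0 mulr0.
by have := ler_pM (isT : 0 <= 2 :> int) (isT : 0 <= 1 :> int) m2 n1; rewrite E.
Qed.

(** The numbers [(w + K) / 2] and [(w - K) / 2] are Gaussian integers with product 1, hence units
    conjugate to each other. Their sum [w] is real, their difference [K] is imaginary, and a unit of
    Z[i] has a zero coordinate. *)
Lemma gaussInteger_unit (K w : algC) :
  K \is a gaussInteger -> w \is a gaussInteger ->
  K ^+ 2 + 4 = w ^+ 2 -> K = 0 \/ w = 0.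
Proof.
move=> hK hw E.
have i2 : 'i ^+ 2 = -1 :> algC by rewrite sqrCi.
have h1 : 1 \is a gaussInteger by apply/gaussIntegerP; exists 1, 0; ring.
have := gaussInteger_half hw hK h1; rewrite -E => /(_ ltac:(ring)).
have hKN : - K \is a gaussInteger.
  by case/gaussIntegerP: hK => x [y ->]; apply/gaussIntegerP; exists (- x), (- y); ring.
have := gaussInteger_half hw hKN h1; rewrite sqrrN -E => /(_ ltac:(ring)).
move=> /gaussIntegerP[x [y Ev]] /gaussIntegerP[x' [y' Eu]].
have {E} /rect_int_inj[E1 E2] :
    (x * x' - y * y')%:~R + 'i * (x * y' + x' * y)%:~R = 1%:~R + 'i * 0%:~R :> algC.
  transitivity ((x%:~R + 'i * y%:~R) * (x'%:~R + 'i * y'%:~R) : algC).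
    by ring: i2.
  rewrite -Ev -Eu; transitivity ((w ^+ 2 - K ^+ 2) / 4); first by field.
  by rewrite -E; field.
have N : (x * x + y * y) * (x' * x' + y' * y') = 1.
  transitivity ((x * x' - y * y') ^+ 2 + (x * y' + x' * y) ^+ 2); first by ring.
  by rewrite E1 E2.
have Ew : w = (x + x')%:~R + 'i * (y + y')%:~R.
  transitivity ((w - - K) / 2 + (w - K) / 2); first by field.
  by rewrite Ev Eu; ring.
have EK : K = (x - x')%:~R + 'i * (y - y')%:~R.
  transitivity ((w - - K) / 2 - (w - K) / 2); first by field.
  by rewrite Ev Eu; ring.
have [n [Hn1 Hn2]] : exists n, n = x * x + y * y /\ n = 1.
  exists (x * x + y * y); split=> //.
  have hA : 0 <= x * x + y * y by rewrite addr_ge0 // -expr2 sqr_ge0.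
  have hB : 0 <= x' * x' + y' * y' by rewrite addr_ge0 // -expr2 sqr_ge0.
  exact: int_mul_eq1 N hA hB.
have Ex' : x' = x.
  have : x * (x * x' - y * y') + y * (x * y' + x' * y) = x' * (x * x + y * y) by ring.
  by rewrite E1 E2 -Hn1 Hn2; lia.
have Ey' : y' = - y.
  have : - y * (x * x' - y * y') + x * (x * y' + x' * y) = y' * (x * x + y * y) by ring.
  by rewrite E1 E2 -Hn1 Hn2; lia.
have [x0|y0] : x = 0 \/ y = 0 by nia.
  by right; rewrite Ew Ex' Ey' x0; ring.
by left; rewrite EK Ex' Ey' y0; ring.
Qed.

(* The elements of a D(4)-quadruple are halved so that 4 becomes 1. It is enough to
   record that 2 p takes values in Z[i] at natural numbers: this is stable under the
   extensions below, and it puts the constant extensions in Z[i] / 2. *)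
Definition halfGauss (p : P) := forall n : nat, (2 * p).[n%:R] \is a gaussInteger.

Lemma gaussIntegerD (x y : algC) : x \is a gaussInteger -> y \is a gaussInteger ->
  x + y \is a gaussInteger.
Proof. exact: rpredD. Qed.

Lemma gaussIntegerN (x : algC) : x \is a gaussInteger -> - x \is a gaussInteger.
Proof. by move=> h; rewrite rpredN. Qed.

Lemma gaussIntegerM (x y : algC) : x \is a gaussInteger -> y \is a gaussInteger ->
  x * y \is a gaussInteger.
Proof. exact: rpredM. Qed.

Lemma gaussInteger_nat (n : nat) : n%:R \is a gaussInteger.
Proof. by rewrite rpred_nat. Qed.

Lemma horner_nat (n : nat) (x : algC) : n%:R.[x] = n%:R.
Proof. by rewrite -(rmorph_nat (@polyC algC)) hornerC. Qed.

Definition horner_simp :=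
  (hornerD, hornerN, hornerM, horner_exp, horner_nat, hornerC).

Definition root_of (r a b : P) := halfGauss r /\ r ^+ 2 = a * b + 1.

Lemma root_ofC r a b : root_of r a b -> root_of r b a.
Proof. by case=> h1 h2; split=> //; rewrite h2 mulrC. Qed.

Lemma halfGaussN p : halfGauss p -> halfGauss (- p).
Proof. by move=> h n; have := gaussIntegerN (h n); rewrite -hornerN mulrN. Qed.

Lemma root_ofN r a b : root_of r a b -> root_of (- r) a b.
Proof. by case=> h1 h2; split; [exact: halfGaussN | rewrite sqrrN]. Qed.

Lemma halfGauss_horner p n : halfGauss p -> 2 * p.[n%:R] \is a gaussInteger.
Proof. by move/(_ n); rewrite hornerM horner_nat. Qed.

(** With capitals for doubled values, [R^2 S^2 - A^2 T^2 = 4 (R^2 + S^2 - 4 - A^2)], so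
    [gaussInteger_half] puts [(R S + A T) / 2], the double of [r s + a t], in Z[i]. *)
Lemma halfGauss_mul a b c r s t :
  halfGauss a -> root_of r a b -> root_of s a c -> root_of t b c ->
  halfGauss (r * s + a * t).
Proof.
move=> Ha [Hr Er] [Hs Es] [Ht Et] n.

have [a' r' s' t'] := And4 (halfGauss_horner n Ha) (halfGauss_horner n Hr)
  (halfGauss_horner n Hs) (halfGauss_horner n Ht).
have h4 := gaussInteger_nat 4.
have B : forall p q e : P, e ^+ 2 = p * q + 1 ->
    (2 * p.[n%:R]) * (2 * q.[n%:R]) = (2 * e.[n%:R]) ^+ 2 - 4.
  move=> p q e /(congr1 (fun u => u.[n%:R])); rewrite !horner_simp => E.
  by move: p.[_] q.[_] e.[_] E => u v w E; ring: E.
have b1 := B _ _ _ Er; have b2 := B _ _ _ Es; have b3 := B _ _ _ Et.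
have hf := gaussIntegerM r' s'; have hg := gaussIntegerN (gaussIntegerM a' t').
have hh := gaussIntegerD (gaussIntegerD (gaussIntegerM r' r') (gaussIntegerM s' s'))
  (gaussIntegerD (gaussIntegerN h4) (gaussIntegerN (gaussIntegerM a' a'))).
have := gaussInteger_half hf hg hh; rewrite !horner_simp.
move: b1 b2 b3; move: a.[_] b.[_] c.[_] r.[_] s.[_] t.[_] => av bv cv rv sv tv b1 b2 b3.
have -> : 2 * (rv * sv + av * tv) =
  (2 * rv * (2 * sv) - - (2 * av * (2 * tv))) / 2 by field.
apply.
have n4 : 4%:R != 0 :> algC by rewrite pnatr_eq0.
have e1 : av * bv = rv ^+ 2 - 1.
  by apply: (mulfI n4); transitivity (2 * av * (2 * bv)); [ring|rewrite b1; ring].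
have e2 : av * cv = sv ^+ 2 - 1.
  by apply: (mulfI n4); transitivity (2 * av * (2 * cv)); [ring|rewrite b2; ring].
have e3 : tv ^+ 2 = bv * cv + 1 by transitivity ((2 * bv * (2 * cv)) / 4 + 1); [rewrite b3; field|field].
transitivity (16 * (rv ^+ 2 * sv ^+ 2 - av * bv * (av * cv) - av ^+ 2)).
  by ring: e3.
by rewrite e1 e2; ring.
Qed.

(** With capitals for doubled values, the double of the sum is [A + B + C + (A B C + R S T) / 2],
    and [(R S T)^2 - (A B C)^2] is a multiple of 4. *)
Lemma halfGauss_next a b c r s t :
  halfGauss a -> halfGauss b -> halfGauss c ->
  root_of r a b -> root_of s a c -> root_of t b c ->
  halfGauss (a + b + c + 2 * a * b * c + 2 * r * s * t).
Proof.
move=> Ha Hb Hc [Hr Er] [Hs Es] [Ht Et] n.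
have [a' b' c'] := And3 (halfGauss_horner n Ha) (halfGauss_horner n Hb) (halfGauss_horner n Hc).
have [r' s' t'] := And3 (halfGauss_horner n Hr) (halfGauss_horner n Hs) (halfGauss_horner n Ht).
have h4 := gaussInteger_nat 4.
have B : forall p q e : P, e ^+ 2 = p * q + 1 -> (e.[n%:R]) ^+ 2 = p.[n%:R] * q.[n%:R] + 1.
  by move=> p q e /(congr1 (fun u => u.[n%:R])); rewrite !horner_simp.
have b1 := B _ _ _ Er; have b2 := B _ _ _ Es; have b3 := B _ _ _ Et.
have hg := gaussIntegerM (gaussIntegerM a' b') c'.
have hf := gaussIntegerM (gaussIntegerM r' s') t'.
have m := gaussIntegerM; have ad := gaussIntegerD; have ng := gaussIntegerN.
have AB := m _ _ a' b'; have AC := m _ _ a' c'; have BC := m _ _ b' c'.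
have hh := ad _ _ (ad _ _ (ad _ _ (m _ _ AB AC) (m _ _ AB BC)) (m _ _ AC BC))
  (m _ _ h4 (ad _ _ h4 (ad _ _ AB (ad _ _ AC BC)))).
have := gaussInteger_half hf hg hh; rewrite !horner_simp.
move: b1 b2 b3 a' b' c' hg.
move: a.[_] b.[_] c.[_] r.[_] s.[_] t.[_] => av bv cv rv sv tv b1 b2 b3 a' b' c' hg.
move/(_ ltac:(ring: b1 b2 b3)) => hu.
have := ad _ _ (ad _ _ a' b') (ad _ _ c' (ad _ _ hg hu)).
by congr (_ \is a gaussInteger); field.
Qed.

(* The only use of the arithmetic of Z[i]: over a field containing sqrt(-3) there are
   irregular quadruples, built from constants k with k ^+ 2 + 1 a nonzero square. *)
Lemma halfGauss_const_unit k w :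
  halfGauss k -> halfGauss w -> k ^+ 2 + 1 = w ^+ 2 -> deg k = 0%N -> k = 0 \/ w = 0.
Proof.
move=> Hk Hw E dk.
have dw : deg w = 0%N.
  have : (deg (w ^+ 2) <= 0)%N by rewrite -E; deg_tac.
  by rewrite deg_sqr; lia.
have [x Ex] := deg_eq0P dk; have [y Ey] := deg_eq0P dw.
have := halfGauss_horner 0 Hk; have := halfGauss_horner 0 Hw.
rewrite Ex Ey !hornerC => hy hx.
have Exy : x ^+ 2 + 1 = y ^+ 2.
  by apply: polyC_inj; rewrite polyCD !polyC_exp -Ex -Ey.
have E2 : (2 * x) ^+ 2 + 4 = (2 * y) ^+ 2 by rewrite !exprMn -Exy; ring.
have h2 : 2%:R != 0 :> algC by rewrite pnatr_eq0.
by case: (gaussInteger_unit hx hy E2) => /eqP; rewrite mulf_eq0 (negPf h2) /= => /eqP ->;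
  [left|right].
Qed.

(** * Triples and their regular extensions *)

Lemma nat_neq0P (n : nat) : (n.+1%:R : P) != 0.
Proof. by rewrite natP_eq0. Qed.

Lemma deg_root (r a b : P) : r ^+ 2 = a * b + 1 -> a != 0 -> b != 0 ->
  (2 * deg r = deg a + deg b)%N.
Proof.
move=> E ha hb; rewrite -deg_sqr E -degM //.
have [h0|h0] := posnP (deg (a * b)); last by rewrite degDl // deg1.
have : (deg (a * b + 1) <= maxn 0 0)%N by apply: degD_le; rewrite ?h0 ?deg1.
by rewrite h0; dlia.
Qed.

(** Both [x - y] and [x + y] divide a nonzero constant. *)
Lemma sqr_diff_const (x y k : P) : x ^+ 2 - y ^+ 2 = k -> k != 0 -> deg k = 0%N ->
  deg x = 0%N /\ deg y = 0%N.
Proof.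
move=> E hk dk; have E' : (x - y) * (x + y) = k by rewrite -E; ring.
have [d1 d2] : deg (x - y) = 0%N /\ deg (x + y) = 0%N by apply: mul_const; rewrite E'.
have X : deg (2%:R * x) = 0%N.
  have -> : 2%:R * x = (x - y) + (x + y) by ring.
  by apply/eqP; rewrite -leqn0; apply: (@degD_le _ _ 0 0); rewrite ?d1 ?d2.
have Y : deg (2%:R * y) = 0%N.
  have -> : 2%:R * y = - (x - y) + (x + y) by ring.
  by apply/eqP; rewrite -leqn0; apply: (@degD_le _ _ 0 0); rewrite ?degN ?d1 ?d2.
by move: X Y; rewrite !deg_natM.
Qed.

Lemma const_sqrt (k : P) : deg k = 0%N -> exists2 u : P, deg u = 0%N & u ^+ 2 = k.
Proof.
move=> /deg_eq0P[x ->]; exists (sqrtC x)%:P; first by rewrite degC.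
by rewrite -polyC_exp sqrtCK.
Qed.

Lemma sqr_neq0 (u k : P) : u ^+ 2 = k -> k != 0 -> u != 0.
Proof. by move=> <-; apply: contra => /eqP ->; rewrite expr0n. Qed.

Lemma sqr_multiple_const (k a f : P) : deg k = 0%N -> k != 0 ->
  f ^+ 2 = k * a ^+ 2 + 1 -> deg a = 0%N.
Proof.
move=> dk hk E; have [u du Eu] := const_sqrt dk.
have [_] : deg f = 0%N /\ deg (u * a) = 0%N.
  by apply: (@sqr_diff_const _ _ 1); rewrite ?deg1 ?oner_eq0 // exprMn E Eu; ring.
have [->|ha] := eqVneq a 0; first by rewrite deg0.
by rewrite degM ?du //; apply: sqr_neq0 Eu hk.
Qed.

Lemma deg_linear (k y p : P) : deg k = 0%N -> k != 0 -> p ^+ 2 = k * y + 1 ->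
  deg p = 0%N -> deg y = 0%N.
Proof.
move=> dk hk E dp; have [->|hy] := eqVneq y 0; first by rewrite deg0.
by have := deg_root E hk hy; dlia.
Qed.

(** If [k] and [l] differ, [l p^2 - k q^2 = l - k] is a nonzero constant; with square roots of [k]
    and [l] it is a difference of two squares, so [p] and then [y] are constant. Hence a set with a
    nonconstant element contains at most one constant. *)
Lemma two_const (k l y p q : P) : deg k = 0%N -> deg l = 0%N -> k != 0 -> l != 0 ->
  p ^+ 2 = k * y + 1 -> q ^+ 2 = l * y + 1 -> (0 < deg y)%N -> k = l.
Proof.
move=> dk dl hk hl Ep Eq dy; apply/eqP; apply/negPn/negP => hkl.
have [u du Eu] := const_sqrt dk; have [v dv Ev] := const_sqrt dl.
have [dp _] : deg (v * p) = 0%N /\ deg (u * q) = 0%N.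
  apply: (@sqr_diff_const _ _ (l - k)); last by apply/eqP; rewrite -leqn0; deg_tac.
    by rewrite !exprMn Ep Eq Eu Ev; ring.
  by rewrite subr_eq0 eq_sym.
have hp : p != 0.
  apply/eqP => p0; move: Ep; rewrite p0 expr0n /= => /esym/eqP.
  rewrite addr_eq0 => /eqP E; have := degM hk (deg_gt0_neq0 dy).
  by rewrite E degN deg1; dlia.
have hv := sqr_neq0 Ev hl.
by move: dp; rewrite degM // => dp; have := deg_linear dk hk Ep; dlia.
Qed.

(** The right-hand side is [(2 r s t)^2], so this says [d = a + b + c + 2 a b c ± 2 r s t] without
    naming the roots. *)
Definition regular (a b c d : P) : Prop :=
  (d - (a + b + c + 2 * a * b * c)) ^+ 2 = 4 * (a * b + 1) * (a * c + 1) * (b * c + 1).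

(** This form is symmetric in the four elements, which makes regularity independent of their
    order. *)
Lemma regular_sums a b c d : regular a b c d <->
  a ^+ 2 + b ^+ 2 + c ^+ 2 + d ^+ 2
    = 2 * (a * b + a * c + a * d + b * c + b * d + c * d) + 4 * a * b * c * d + 4.
Proof.
rewrite /regular; split => E; apply/eqP; rewrite -subr_eq0; apply/eqP.
  rewrite -[RHS](subrr (4 * (a * b + 1) * (a * c + 1) * (b * c + 1))) -{1}E; ring.
by move/eqP: E; rewrite -subr_eq0 => /eqP E; rewrite -E; ring.
Qed.

Record triple (a b c r s t : P) : Prop := Triple {
  tripleA : halfGauss a; tripleB : halfGauss b; tripleC : halfGauss c;
  tripleR : root_of r a b; tripleS : root_of s a c; tripleT : root_of t b c }.

Lemma triple_flip a b c r s t : triple a b c r s t -> triple a b c r s (- t).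
Proof. by case=> *; split=> //; apply: root_ofN. Qed.

(* The second regular extension is ext a b c r s (- t). *)
Definition ext (a b c r s t : P) : P := a + b + c + 2 * a * b * c - 2 * r * s * t.

Lemma ext_root_a a b c r s t : triple a b c r s t ->
  root_of (r * s - a * t) a (ext a b c r s t).
Proof.
case=> ha hb hc hr hs ht; split.
  by rewrite -mulrN; apply: (halfGauss_mul ha hr hs (root_ofN ht)).
case: hr hs ht => [_ Er] [_ Es] [_ Et]; rewrite /ext; ring: Er Es Et.
Qed.

Lemma ext_root_b a b c r s t : triple a b c r s t ->
  root_of (b * s - r * t) b (ext a b c r s t).
Proof.
case=> ha hb hc hr hs ht; split.
  have := halfGauss_mul hb (root_ofC hr) (root_ofN ht) hs.
  by congr halfGauss; ring.
case: hr hs ht => [_ Er] [_ Es] [_ Et]; rewrite /ext; ring: Er Es Et.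
Qed.

Lemma ext_root_c a b c r s t : triple a b c r s t ->
  root_of (c * r - s * t) c (ext a b c r s t).
Proof.
case=> ha hb hc hr hs ht; split.
  have := halfGauss_mul hc (root_ofC hs) (root_ofN (root_ofC ht)) hr.
  by congr halfGauss; ring.
case: hr hs ht => [_ Er] [_ Es] [_ Et]; rewrite /ext; ring: Er Es Et.
Qed.

Lemma ext_halfGauss a b c r s t : triple a b c r s t -> halfGauss (ext a b c r s t).
Proof.
case=> ha hb hc hr hs ht; have := halfGauss_next ha hb hc hr hs (root_ofN ht).
by congr halfGauss; rewrite /ext; ring.
Qed.

Lemma regular_ext a b c r s t d : triple a b c r s t -> regular a b c d ->
  exists2 t', triple a b c r s t' & d = ext a b c r s t' /\ (t' = t \/ t' = - t).
Proof.
move=> tr; have [_ _ _ [_ Er] [_ Es] [_ Et]] := tr; rewrite /regular -Er -Es -Et.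
have -> : 4 * r ^+ 2 * s ^+ 2 * t ^+ 2 = (2 * r * s * t) ^+ 2 by ring.
move=> /sqrf_eq[] E; [exists (- t); first exact: triple_flip|exists t => //].
  by split; [rewrite /ext -[LHS](subrK (a + b + c + 2 * a * b * c)) E; ring|right].
by split; [rewrite /ext -[LHS](subrK (a + b + c + 2 * a * b * c)) E; ring|left].
Qed.

(** The two regular extensions are the roots of a quadratic equation, and this is its constant term.
    It vanishes exactly when [c = a + b ± 2 r]. *)
Lemma ext_mul a b c r s t : triple a b c r s t ->
  ext a b c r s t * ext a b c r s (- t) = (c - (a + b)) ^+ 2 - 4 * r ^+ 2.
Proof. by case=> _ _ _ [_ Er] [_ Es] [_ Et]; rewrite /ext; ring: Er Es Et. Qed.

Lemma ext_add a b c r s t :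
  ext a b c r s t + ext a b c r s (- t) = 2%:R * (a + b + c + 2%:R * (a * b * c)).
Proof. rewrite /ext; ring. Qed.

Lemma deg_ext_add a b c r s t : a != 0 -> b != 0 -> (deg a <= deg c)%N ->
  (deg b <= deg c)%N -> (0 < deg c)%N -> (0 < deg a + deg b)%N ->
  deg (ext a b c r s t + ext a b c r s (- t)) = (deg a + deg b + deg c)%N.
Proof.
move=> ha hb h1 h2 h3 h4; have hc := deg_gt0_neq0 h3.
have E : deg (2%:R * (a * b * c)) = (deg a + deg b + deg c)%N.
  by rewrite deg_natM // !degM ?mulf_neq0.
rewrite ext_add deg_natM // degDr ?E //; deg_tac.
Qed.

(** The sum of the two extensions has degree [deg a + deg b + deg c] and their product has degree
    [2 deg c], so the smaller one has degree [deg c - deg a - deg b]. *)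
Lemma deg_ext a b c r s t : triple a b c r s t -> a != 0 -> b != 0 ->
  (deg a <= deg b)%N -> (deg b < deg c)%N -> (0 < deg b)%N ->
  (deg (ext a b c r s t) < deg a + deg b + deg c)%N ->
  ext a b c r s t != 0 /\ (deg (ext a b c r s t) + deg a + deg b = deg c)%N.
Proof.
move=> tr ha hb h1 h2 h3 h4; have [_ _ _ [_ Er] _ _] := tr.
have hr := deg_root Er ha hb.
have M := ext_mul tr.
have dM : deg ((c - (a + b)) ^+ 2 - 4 * r ^+ 2) = (2 * deg c)%N.
  have E : deg ((c - (a + b)) ^+ 2) = (2 * deg c)%N.
    by rewrite deg_sqr degDl // degN; deg_tac.
  rewrite degDl E //; deg_tac.
have S := @deg_ext_add a b c r s t ha hb; move: S => /(_ ltac:(dlia) ltac:(dlia) ltac:(dlia) ltac:(dlia)) S.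
have nz : ext a b c r s t * ext a b c r s (- t) != 0.
  by rewrite M; apply: deg_gt0_neq0; rewrite dM; dlia.
move: (nz); rewrite mulf_eq0 negb_or => /andP[n1 n2]; split=> //.
move: dM; rewrite -M degM // => dM.
have [] := leqP (deg (ext a b c r s (- t))) (deg (ext a b c r s t)) => hle.
  have : (deg (ext a b c r s t + ext a b c r s (- t)) <= deg (ext a b c r s t))%N.
    by deg_tac.
  by rewrite S; dlia.
by move: S; rewrite degDr //; dlia.
Qed.

Lemma small_ext_exists a b c r s t : triple a b c r s t -> a != 0 -> b != 0 ->
  (deg a <= deg b)%N -> (deg b < deg c)%N -> (0 < deg b)%N ->
  exists2 t', t' = t \/ t' = - t & let e := ext a b c r s t' in
    e != 0 /\ (deg e + deg a + deg b = deg c)%N.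
Proof.
move=> tr ha hb h1 h2 h3.
have [h|h] := leqP (deg a + deg b + deg c) (deg (ext a b c r s t)); last first.
  by exists t; [left|apply: deg_ext].
exists (- t); first by right.
apply: deg_ext => //; first exact: triple_flip.
have M := ext_mul tr; have [_ _ _ [_ Er] _ _] := tr; have hr := deg_root Er ha hb.
have : (deg (ext a b c r s t * ext a b c r s (- t)) <= 2 * deg c)%N.
  by rewrite M; deg_tac.
have [->|n2] := eqVneq (ext a b c r s (- t)) 0; first by rewrite deg0; dlia.
have n1 : ext a b c r s t != 0 by apply: deg_gt0_neq0; dlia.
by rewrite degM //; dlia.
Qed.

(* One of the two regular extensions has degree at most - deg x: it is 0, or a constant
   which then has to be x itself. *)
Lemma triple_type x y z r s t : triple x y z r s t -> x != 0 ->
  (deg x <= deg y)%N -> deg y = deg z -> (0 < deg y)%N ->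
  (z - x - y) ^+ 2 = 4 * (x * y + 1) \/ x ^+ 2 = -1 /\ z = 2 * x - y.
Proof.
move=> tr hx h1 h2 h3.
have hy := deg_gt0_neq0 h3; have hz : z != 0 by apply: deg_gt0_neq0; dlia.
(* The degree of the sum of the two extensions shows that one of them is large; the sign of [t]
   makes it the second one. *)
wlog big : t tr / (deg x + deg y + deg z <= deg (ext x y z r s (- t)))%N.
  move=> W; have S := @deg_ext_add x y z r s t hx hy ltac:(dlia) ltac:(dlia) ltac:(dlia) ltac:(dlia).
  have [h|h] := leqP (deg x + deg y + deg z) (deg (ext x y z r s (- t))); first exact: (W t).
  have [h'|h'] := leqP (deg x + deg y + deg z) (deg (ext x y z r s t)).
    by apply: (W (- t)); [exact: triple_flip|rewrite opprK].
  suff : (deg (ext x y z r s t + ext x y z r s (- t)) < deg x + deg y + deg z)%N by dlia.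
  deg_tac.
have M := ext_mul tr; have [_ _ _ [hr Er] [hs Es] [ht Et]] := tr.
have [e0|ne] := eqVneq (ext x y z r s t) 0.
  left; rewrite -Er; apply/eqP; rewrite -subr_eq0.
  by move/esym/eqP: M; rewrite e0 mul0r; congr (_ == _); ring.
have nE : ext x y z r s (- t) != 0 by apply: deg_gt0_neq0; dlia.
have hdr := deg_root Er hx hy.
have : (deg (ext x y z r s t * ext x y z r s (- t)) <= 2 * deg z)%N.
  by rewrite M; deg_tac.
rewrite degM // => D.
have [hwa wa] := ext_root_a tr; have [_ wb] := ext_root_b tr.
(* The bound [D] leaves no room: [x] and the extension are both constants, and both extend the
   nonconstant [y]. *)
have ex : x = ext x y z r s t.
  apply: (@two_const _ _ y r (y * s - r * t)) => //; [dlia|dlia|by rewrite wb mulrC].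
have E1 : x ^+ 2 + 1 = (r * s - x * t) ^+ 2 by rewrite wa -ex.
case: (halfGauss_const_unit (tripleA tr) hwa E1 ltac:(dlia)) => [x0|w0].
  by rewrite x0 eqxx in hx.
right; split; first by apply/eqP; rewrite -subr_eq0 opprK E1 w0 expr0n.
move: ex; rewrite /ext; have -> : 2 * r * s * t = 2 * x * (t ^+ 2).
  by transitivity (2 * t * (r * s - x * t) + 2 * x * t ^+ 2); [ring|rewrite w0; ring].
rewrite Et => ex; apply/eqP; rewrite -subr_eq0; move/eqP: ex; rewrite -subr_eq0.
by rewrite -oppr_eq0; congr (_ == _); ring.
Qed.

(** * Chains of extensions of a pair *)

(* A state (d, x, z) records an extension d of the pair {a, c} with the roots of
   a d + 1 and c d + 1; up multiplies x sqrt(c) + z sqrt(a) by the unit s + sqrt(a c). *)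
Definition sol (a c : P) (v : P * P * P) : Prop :=
  [/\ halfGauss v.1.1, root_of v.1.2 a v.1.1 & root_of v.2 c v.1.1].

Definition up (a c s : P) (v : P * P * P) : P * P * P :=
  (a + c + v.1.1 + 2 * a * c * v.1.1 + 2 * s * v.1.2 * v.2,
   s * v.1.2 + a * v.2, s * v.2 + c * v.1.2).

Lemma sol_flip a c d x z : sol a c (d, x, z) -> sol a c (d, - x, z).
Proof. by case=> h1 h2 h3; split=> //; apply: root_ofN. Qed.

Lemma sol_up a c s v : halfGauss a -> halfGauss c -> root_of s a c ->
  sol a c v -> sol a c (up a c s v).
Proof.
case: v => [[d x] z] ha hc hs [/= hd hx hz]; split=> /=.
- have := halfGauss_next ha hc hd hs hx hz; by congr halfGauss; ring.
- split; first exact: (halfGauss_mul ha hs hx hz).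
  case: hs hx hz => [_ Es] [_ /= Ex] [_ /= Ez]; rewrite /up /=; ring: Es Ex Ez.
- split; first exact: (halfGauss_mul hc (root_ofC hs) hz hx).
  case: hs hx hz => [_ Es] [_ /= Ex] [_ /= Ez]; rewrite /up /=; ring: Es Ex Ez.
Qed.

Lemma sol_iter a c s v n : halfGauss a -> halfGauss c -> root_of s a c ->
  sol a c v -> sol a c (iter n (up a c s) v).
Proof. by move=> ha hc hs hv; elim: n => //= n IH; apply: sol_up. Qed.

Lemma congr_sqr1 c r b : r ^+ 2 = b * c + 1 -> congr c (r ^+ 2) 1.
Proof. by move=> ->; exists b; ring. Qed.

(** Modulo [c] the squares of [s] and of every [z] are 1. Hence each step adds [a] to [s x z], and
    summing the increments of [d] gives the quadratic expression in [n]. *)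
Lemma chain_congr a c s w n : s ^+ 2 = a * c + 1 -> sol a c w ->
  let v := iter n (up a c s) w in
  [/\ congr c v.1.1 (a * n%:R ^+ 2 + 2 * n%:R * (s * w.1.2 * w.2) + w.1.1),
      congr c (s * v.1.2 * v.2) (s * w.1.2 * w.2 + n%:R * a),
      congr c v.2 (if odd n then s * w.2 else w.2) & congr c (v.2 ^+ 2) 1].
Proof.
move=> Es [hd [_ Ex] [_ Ez]]; elim: n => [|n [IH1 IH2 IH3 IH4]] /=.
  split; first by (exists 0; ring); try exact: congr_refl.
  - by exists 0; ring.
  - exact: congr_refl.
  - by exists w.1.1; rewrite Ez; ring.
set v := iter n _ w in IH1 IH2 IH3 IH4 *.
case: IH1 => k1 E1; case: IH2 => k2 E2; case: IH4 => k4 E4.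
split.
- exists (1 + 2 * a * v.1.1 + k1 + 2 * k2).
  have -> : a + c + v.1.1 + 2 * a * c * v.1.1 + 2 * s * v.1.2 * v.2 =
     a + c + v.1.1 + 2 * a * c * v.1.1 + 2 * (s * v.1.2 * v.2) by ring.
  by rewrite {1}E1 E2; ring.
- exists (k2 + a * k4 + (a * (s * v.1.2 * v.2)) + s * v.1.2 * (s * v.1.2)
    + s * a * v.2 * v.1.2 + a ^+ 2 * v.2 ^+ 2).
  transitivity (s * v.1.2 * v.2 * s ^+ 2 + a * v.2 ^+ 2 * s ^+ 2 + c * (s * v.1.2 * (s * v.1.2)
    + s * a * v.2 * v.1.2)); first by ring.
  by rewrite Es E4 E2; ring.
- case: IH3 => k3; case: (odd n) => /= E3.
    exists (s * k3 + a * w.2 + v.1.2).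
    transitivity (s * v.2 + c * v.1.2) => //.
    rewrite E3; transitivity (s ^+ 2 * w.2 + c * (s * k3) + c * v.1.2); first by ring.
    by rewrite Es; ring.
  by exists (s * k3 + v.1.2); rewrite E3; ring.
- exists (a + k4 + a * c * k4 + 2 * s * v.2 * v.1.2 + c * v.1.2 ^+ 2).
  transitivity (s ^+ 2 * v.2 ^+ 2 + c * (2 * s * v.2 * v.1.2 + c * v.1.2 ^+ 2)); first by ring.
  by rewrite Es E4; ring.
Qed.

Definition down (a c s : P) (v : P * P * P) : P * P * P :=
  (a + c + v.1.1 + 2 * a * c * v.1.1 - 2 * s * v.1.2 * v.2,
   s * v.1.2 - a * v.2, s * v.2 - c * v.1.2).

Lemma up_down a c s v : s ^+ 2 = a * c + 1 -> sol a c v -> up a c s (down a c s v) = v.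
Proof.
case: v => [[d x] z] Es [_ [_ /= Ex] [_ /= Ez]]; rewrite /up /down /=.
congr (_, _, _); ring: Es Ex Ez.
Qed.

Lemma down_up a c s v : s ^+ 2 = a * c + 1 -> sol a c v -> down a c s (up a c s v) = v.
Proof.
case: v => [[d x] z] Es [_ [_ /= Ex] [_ /= Ez]]; rewrite /up /down /=.
congr (_, _, _); ring: Es Ex Ez.
Qed.

Lemma sol_down a c s v : halfGauss a -> halfGauss c -> root_of s a c ->
  sol a c v -> sol a c (down a c s v).
Proof.
case: v => [[d x] z] ha hc hs /sol_flip hv.
have := sol_flip (sol_up ha hc hs hv); rewrite /up /down /=.
by congr sol; congr (_, _, _); ring.
Qed.

Lemma sol_neq0 a c v : (0 < deg c)%N -> sol a c v -> v.2 != 0.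
Proof.
move=> hc [_ _ [_ Ez]]; apply/eqP => z0; move: Ez; rewrite z0 expr0n /= => /esym/eqP.
rewrite addr_eq0 => /eqP E.
have hd : v.1.1 != 0.
  by apply/eqP => d0; move/eqP: E; rewrite d0 mulr0 eq_sym oppr_eq0 oner_eq0.
by have := degM (deg_gt0_neq0 hc) hd; rewrite E degN deg1; dlia.
Qed.

Lemma neighbour_mul a c s d x z : s ^+ 2 = a * c + 1 -> sol a c (d, x, z) ->
  (s * z - c * x) * (s * z + c * x) = z ^+ 2 + c * a - c ^+ 2.
Proof. by move=> Es [_ [_ /= Ex] [_ /= Ez]]; ring: Es Ex Ez. Qed.

Lemma deg_s_gt0 a c s : s ^+ 2 = a * c + 1 -> a != 0 -> (0 < deg c)%N ->
  s != 0 /\ (2 * deg s = deg a + deg c)%N.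
Proof.
move=> Es ha hc; have h := deg_root Es ha (deg_gt0_neq0 hc).
by split=> //; apply: deg_gt0_neq0; dlia.
Qed.

(** Here [u] and [v] are the roots [z] of the states below and above. Their sum [2 s z] forces one
    of them up to degree [deg s + deg z], while their product [z^2 + c a - c^2] bounds the sum of
    their degrees, so the other one is small. *)
Lemma neighbour_degs a c s d x z : halfGauss a -> halfGauss c -> root_of s a c ->
  a != 0 -> (0 < deg c)%N -> (deg a <= deg c)%N -> sol a c (d, x, z) ->
  let u := s * z - c * x in let v := s * z + c * x in
  [/\ u != 0, v != 0, (deg u + deg v <= maxn (2 * deg z) (2 * deg c))%N,
      (deg s + deg z <= maxn (deg u) (deg v))%N
    & (deg c < deg z -> deg u + deg v = 2 * deg z)%N].
Proof.
move=> ha hc hs a0 dc dac hv u v; have Es := hs.2.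
have u0 : u != 0 by apply: (sol_neq0 dc (sol_down ha hc hs hv)).
have v0 : v != 0 by apply: (sol_neq0 dc (sol_up ha hc hs hv)).
have z0 : z != 0 := sol_neq0 dc hv.
have [s0 _] := deg_s_gt0 Es a0 dc.
have M := neighbour_mul Es hv.
split=> //.
- rewrite -degM // M; deg_tac.
- have <- : deg (u + v) = (deg s + deg z)%N.
    by rewrite -degM // -[RHS](@deg_natM 2) //; congr deg; rewrite /u /v; ring.
  by apply: degD_le.
- move=> h; rewrite -degM // M -addrA degDl; first by rewrite deg_sqr.
  by rewrite deg_sqr; deg_tac.
Qed.

(** The condition on [K] is what makes one neighbour smaller than [z] as long as [deg z > K]. The
    sign of [x] is chosen once, at the top. The threshold [deg c - 1] yields small starting points,
    the threshold [deg c] yields degrees that can be counted. *)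
Lemma descent a c s K : halfGauss a -> halfGauss c -> root_of s a c ->
  a != 0 -> (0 < deg c)%N -> (deg a <= deg c)%N -> (2 * deg c < 2 * K + 2 + deg s)%N ->
  forall d x z, sol a c (d, x, z) ->
  exists x' n w, [/\ x' = x \/ x' = - x, sol a c w,
    (d, x', z) = iter n (up a c s) w, (deg w.2 <= K)%N
    & (0 < n -> K < deg (up a c s w).2 /\ deg (s * z - c * x') < deg z)%N].
Proof.
move=> ha hc hs a0 dc dac hK d x z; have Es := hs.2.
have [m] := ubnP (deg z); elim: m d x z => // m IH d x z /ltnSE hm hv.
have [hz|hz] := leqP (deg z) K; first by exists x, 0%N, (d, x, z); split=> //; left.
have [_ ds] := deg_s_gt0 Es a0 dc.
wlog small : x hv / (deg (s * z - c * x) < deg z)%N.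
  move=> W; have [u0 v0 h1 h2 _] := neighbour_degs ha hc hs a0 dc dac hv.
  have [h|h] := ltnP (deg (s * z - c * x)) (deg z); first exact: W.
  have [|x' [n [w [Hx' *]]]] := W (- x) (sol_flip hv).
    have -> : s * z - c * (- x) = s * z + c * x by ring.
    by dlia.
  by exists x', n, w; split=> //; rewrite opprK in Hx'; case: Hx'; [right|left].
have hd := sol_down ha hc hs hv; have Euv := up_down Es hv.
case Ev: (down a c s (d, x, z)) hd Euv => [[d1 x1] z1] hd Euv.
have Ez1 : s * z - c * x = z1 := congr1 snd Ev.
have Ez : s * z1 + c * x1 = z := congr1 snd Euv.
have small1 : (deg z1 < deg z)%N by rewrite -Ez1.
have [x' [n [w [Hx' hw Ew dw Hn]]]] := IH d1 x1 z1 (leq_trans small1 hm) hd.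
case: Hx' => Hx'.
  exists x, n.+1, w; split=> //; first by left.
    by rewrite iterS -Ew Hx' Euv.
  move=> _; split=> //; case: n Ew Hn => [|n] Ew Hn; last by case: Hn.
  by move: Ew; rewrite [iter _ _ _]/= => <-; rewrite Hx' Euv.
case: n Ew Hn => [|n] Ew Hn.
  exists x, 1%N, (d1, x1, z1); split=> //; first by left.
  - by move: Ew dw; rewrite [iter _ _ _]/= => <-.
  - by rewrite Euv.
(* A change of sign after the first step would make [z] a neighbour smaller than [z1], against
   [small1]. *)
have [_] := Hn isT; rewrite Hx'.
have -> : s * z1 - c * (- x1) = s * z1 + c * x1 by ring.
by rewrite Ez; dlia.
Qed.

(** Above [deg c] the degrees of the two neighbours of [z] add up to [2 deg z] and the larger is
    [deg s + deg z], so each step adds exactly [deg s]. *)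
Lemma chain_deg a c s w n : halfGauss a -> halfGauss c -> root_of s a c ->
  a != 0 -> (0 < deg c)%N -> (deg a <= deg c)%N -> sol a c w -> (deg w.2 <= deg c)%N ->
  (0 < n -> deg c < deg (up a c s w).2)%N ->
  deg (iter n (up a c s) w).2 = (deg w.2 + n * deg s)%N.
Proof.
move=> ha hc hs a0 dc dac hw dw; have Es := hs.2; have [_ ds] := deg_s_gt0 Es a0 dc.
case: n => [_|n /(_ isT) h1]; first by rewrite addn0.
have D : forall v, sol a c v -> (deg c < deg (up a c s v).2)%N ->
   (deg v.2 < deg (up a c s v).2)%N ->
   deg (up a c s (up a c s v)).2 = (deg s + deg (up a c s v).2)%N /\
   (deg v.2 + deg s)%N = deg (up a c s v).2.
  move=> v hv h2 h3; have hu := sol_up ha hc hs hv.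
  have Edu := down_up Es hv.
  case: (up a c s v) hu h2 h3 Edu => [[d1 x1] z1] hu h2 h3 /(congr1 snd) Ed.
  have [_ _ _ h4 h5] := neighbour_degs ha hc hs a0 dc dac hu.
  have {}Ed : s * z1 - c * x1 = v.2 by [].
  rewrite Ed in h4 h5; have {}h5 := h5 h2.
  rewrite [(_, _, z1).2]/= in h2 h3 *.
  have -> : (up a c s (d1, x1, z1)).2 = s * z1 + c * x1 by [].
  have : (deg (s * z1 + c * x1) <= maxn (deg s + deg z1) (deg v.2))%N.
    have -> : s * z1 + c * x1 = 2%:R * (s * z1) - v.2 by rewrite -Ed; ring.
    deg_tac.
  by dlia.
have hlt : (deg w.2 < deg (up a c s w).2)%N by dlia.
suff [] : [/\ (deg c < deg (iter n.+1 (up a c s) w).2)%N,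
  deg (iter n.+1 (up a c s) w).2 = (deg w.2 + n.+1 * deg s)%N
  & deg (iter n (up a c s) w).2 = (deg w.2 + n * deg s)%N] by [].
elim: n => [|n [IH1 IH2 IH3]].
  have [_ E] := D _ hw h1 hlt; rewrite [iter 1 _ _]/= [iter 0 _ _]/=; split=> //; dlia.
have hi := sol_iter n ha hc hs hw; rewrite [iter n.+2 _ _]iterS.
rewrite iterS in IH1 IH2 *.
have [|E1 E2] := D _ hi IH1; first by rewrite IH2 IH3; dlia.
by rewrite E1; split; dlia.
Qed.

(** * Triples with a dominant element *)

Lemma deg_cofactor (p q m : P) k : p * q = m -> p != 0 -> (deg m <= k)%N ->
  (deg p <= k)%N -> (deg p + deg q <= k)%N.
Proof.
move=> E hp hm hk; have [->|hq] := eqVneq q 0; first by rewrite deg0 addn0.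
by rewrite -degM // E.
Qed.

(** The small extension takes the place of [c]; repeating this goes down a sequence of triples over
    the fixed pair {a, b}. *)
Lemma triple_ext a b c r s t : triple a b c r s t ->
  triple a b (ext a b c r s t) r (r * s - a * t) (r * t - b * s).
Proof.
move=> tr; case: (tr) => ha hb hc hr hs ht; split=> //.
- exact: ext_halfGauss.
- exact: ext_root_a.
- have := root_ofN (ext_root_b tr); by congr root_of; ring.
Qed.

(** The element [c] dominates, and the sign of [t] is fixed so that [ext] is the smaller regular
    extension. *)
Record gap (a b c r s t : P) : Prop := Gap {
  gapT : triple a b c r s t;
  gap_a : a != 0; gap_b : b != 0; gap_ab : a != b;
  gap_dab : (deg a <= deg b)%N; gap_dbc : (deg b < deg c)%N; gap_db : (0 < deg b)%N;
  gap_e : ext a b c r s t != 0;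
  gap_de : (deg (ext a b c r s t) + deg a + deg b = deg c)%N }.

Lemma gap_degs a b c r s t : gap a b c r s t ->
  [/\ (2 * deg r = deg a + deg b)%N, (2 * deg s = deg a + deg c)%N
    & (2 * deg t = deg b + deg c)%N].
Proof.
case=> [[_ _ _ [_ Er] [_ Es] [_ Et]]] ha hb _ _ h1 h2 _ _.
have hc : c != 0 by apply: deg_gt0_neq0; dlia.
by split; apply: deg_root.
Qed.

(* In the lemmas chains_u_v, an extension d occurs at position M in the (a, c)-chain of u
   and at position N in the (b, c)-chain of v. Each chain determines d mod c, and the two
   values have degree less than deg c, so they are equal. *)
Lemma chains_zero_zero a b c r s t (M N : int) : gap a b c r s t ->
  congr c (a * M%:~R ^+ 2 + 2 * M%:~R * s) (b * N%:~R ^+ 2 + 2 * N%:~R * t) ->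
  M = 0 /\ N = 0.
Proof.
move=> G; have [dr ds dt] := gap_degs G.
case: G => [[_ _ _ [_ Er] [_ Es] [_ Et]]] ha hb hab h0 h1 h2 _ _.
move/congr_eq => /(_ ltac:(deg_tac) ltac:(deg_tac)) E.
(* [M s - N t = - (a M^2 - b N^2) / 2], multiplied by its conjugate [M s + N t]. *)
have E1 : (2%:R * c + (M%:~R * s + N%:~R * t)) * (a * M%:~R ^+ 2 - b * N%:~R ^+ 2)
   = 2 * (N ^+ 2 - M ^+ 2)%:~R.
  have {}E : a * M%:~R ^+ 2 - b * N%:~R ^+ 2 = 2 * (N%:~R * t - M%:~R * s).
    by apply/eqP; rewrite -subr_eq0; move/eqP: E; rewrite -subr_eq0; congr (_ == _); ring.
  transitivity (2 * c * (a * M%:~R ^+ 2 - b * N%:~R ^+ 2) +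
     2 * (M%:~R * s + N%:~R * t) * (N%:~R * t - M%:~R * s)); first by rewrite E; ring.
  ring: Er Es Et.
have u0 := mul_deg_eq0 E1; have {u0} : a * M%:~R ^+ 2 - b * N%:~R ^+ 2 = 0.
  apply: u0; apply: leq_ltn_trans (_ : (0 < _)%N); first by deg_tac.
  rewrite degDl deg_natM //; first by dlia.
  deg_tac.
move=> u0; move: E1; rewrite u0 mulr0 => /esym/eqP.
rewrite mulf_eq0 (negPf (nat_neq0P 1)) /= intP_eq0 => /eqP NM.
have {}NM : N ^+ 2 = M ^+ 2 by dlia.
have : (a - b) * (M ^+ 2)%:~R = 0.
  by rewrite -u0 -!rmorphXn /= NM; ring.
move/eqP; rewrite mulf_eq0 subr_eq0 (negPf hab) /= intP_eq0 => /eqP; nia.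
Qed.

(** The root of the starting point [a] is 0, so the first expression has no linear term, and nothing
    balances [2 N t], whose degree exceeds [deg b]. *)
Lemma chains_self_zero a b c r s t (M N : int) : gap a b c r s t -> a ^+ 2 = -1 ->
  congr c (a * M%:~R ^+ 2 + a) (b * N%:~R ^+ 2 + 2 * N%:~R * t) -> False.
Proof.
move=> G a2; have [dr ds dt] := gap_degs G.
case: G => [[_ _ _ [_ Er] [_ Es] [_ Et]]] ha hb hab h0 h1 h2 _ _.
move/congr_eq => /(_ ltac:(deg_tac) ltac:(deg_tac)) E.
have E1 : (2 * N)%:~R * t = a * M%:~R ^+ 2 + a - b * N%:~R ^+ 2 by rewrite E; ring.
have N0 : N = 0.
  by have := mul_int_deg_eq0 E1; move/(_ ltac:(deg_tac)); dlia.
move: E; rewrite N0 -[RHS]/(_) => E.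
have /eqP : a * (M ^+ 2 + 1)%:~R = 0.
  by transitivity (a * M%:~R ^+ 2 + a); [ring|rewrite E; ring].
by rewrite mulf_eq0 (negPf ha) /= intP_eq0 => /eqP; nia.
Qed.

Lemma lincomb_sqrt_eq0 (b r k : P) (M N : int) : (0 < deg r)%N -> (deg r < deg b)%N ->
  deg k = 0%N -> M%:~R * b + N%:~R * r = k -> M = 0 /\ N = 0.
Proof.
move=> h1 h2 h3 E.
have M0 : M = 0.
  by apply: (@mul_int_deg_eq0 _ b (k - N%:~R * r)); [rewrite -E; ring|deg_tac].
split=> //; apply: (@mul_int_deg_eq0 _ r k); last by dlia.
by rewrite -E M0; ring.
Qed.

Lemma sqr_sum_a a (M N : int) : a ^+ 2 = -1 :> P -> a * M%:~R = N%:~R -> M = 0 /\ N = 0.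
Proof.
move=> a2 E; have : (M ^+ 2 + N ^+ 2)%:~R == 0 :> P.
  apply/eqP; transitivity (N%:~R ^+ 2 - a ^+ 2 * M%:~R ^+ 2 : P); first by rewrite a2; ring.
  by rewrite -E; ring.
by rewrite intP_eq0 => /eqP; nia.
Qed.

Lemma deg_sqrN1 (a : P) : a ^+ 2 = -1 -> deg a = 0%N.
Proof. by move=> E; have := deg_sqr a; rewrite E degN deg1; dlia. Qed.

Lemma type_one_root x y z r : r ^+ 2 = x * y + 1 -> (z - x - y) ^+ 2 = 4 * (x * y + 1) ->
  exists2 r', r' = r \/ r' = - r & z = x + y + 2 * r' :> P.
Proof.
move=> <-; have -> : 4 * r ^+ 2 = (2 * r) ^+ 2 by ring.
move=> /sqrf_eq[] E; [exists r; first by left|exists (- r); first by right].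
  by rewrite -E; ring.
by rewrite mulrN -E; ring.
Qed.

Lemma triple_rot a b e r f g : triple a b e r f g -> triple e a b f g r.
Proof. by case=> *; split=> //; apply: root_ofC. Qed.

Lemma int_const_eq (M : int) (a : P) : a != 0 -> a * M%:~R = 0 -> M = 0.
Proof. by move=> ha /eqP; rewrite mulf_eq0 (negPf ha) intP_eq0 => /eqP. Qed.

Lemma eq_lc (k x y p q : P) : x = y -> p - q = k * (x - y) -> p = q.
Proof. by move=> -> E; apply/eqP; rewrite -subr_eq0 E subrr mulr0. Qed.

Lemma eq_lc2 (k l x y u v p q : P) : x = y -> u = v ->
  p - q = k * (x - y) + l * (u - v) -> p = q.
Proof. by move=> -> -> E; apply/eqP; rewrite -subr_eq0 E !subrr !mulr0 addr0. Qed.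

(** The equality reads [N e = (N^2 + N) b + a (N - M^2)]. An even nonzero [N] keeps [N^2 + N] from
    vanishing, so [deg e = deg b] and {a, b, e} has an explicit type: one type gives [N = 0], the
    other [N = -2] and [M^2 = 2]. *)
Lemma chains_self_self a b c r s t e (M N k : int) : gap a b c r s t ->
  e = ext a b c r s t -> a ^+ 2 = -1 -> N = 2 * k -> M != 0 ->
  congr c (a * M%:~R ^+ 2 + a) (b * N%:~R ^+ 2 + N%:~R * (a + b - e) + a) -> False.
Proof.
move=> G Ee a2 Nk M0; have [dr ds dt] := gap_degs G.
case: G => [tr ha hb hab h0 h1 h2]; rewrite -Ee => he de; have a0 := deg_sqrN1 a2.
move/congr_eq => /(_ ltac:(deg_tac) ltac:(deg_tac)) E.
have E1 : N%:~R * e = (N ^+ 2 + N)%:~R * b + a * (N - M ^+ 2)%:~R.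
  by apply: (eq_lc (k := 1) E); ring.
have N0 : N <> 0.
  move=> N0; have /int_const_eq : a * (M ^+ 2)%:~R = 0.
    by apply: (eq_lc (k := 1) E); rewrite N0; ring.
  by move/(_ ha); nia.
have N1 : N ^+ 2 + N <> 0 by nia.
have dE : deg e = deg b.
  rewrite -(@deg_intM N e); last by apply/eqP.
  rewrite E1 degDl deg_intM //; first by apply/eqP.
    by deg_tac.
  by apply/eqP.
have := triple_ext tr; rewrite -Ee => tr2.
have [I|[_ II]] := triple_type tr2 ha ltac:(dlia) ltac:(dlia) ltac:(dlia).
  have [r' Hr' Er'] := type_one_root (tripleR tr).2 I.
  have dr' : deg r' = deg r by case: Hr' => ->; rewrite ?degN.
  have [] : N ^+ 2 = 0 /\ -2 * N = 0; last by nia.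
  apply: (@lincomb_sqrt_eq0 b r' (a * (M ^+ 2)%:~R)); [dlia|dlia| |].
    by apply/eqP; rewrite -leqn0; deg_tac.
  by apply: (eq_lc2 (k := - 1) (l := N%:~R) E1 Er'); ring.
have E2 : (N ^+ 2 + 2 * N)%:~R * b = a * (N + M ^+ 2)%:~R.
  by apply: (eq_lc2 (k := -1) (l := N%:~R) E1 II); ring.
have E3 : N ^+ 2 + 2 * N = 0 by apply: (mul_int_deg_eq0 E2); deg_tac.
have E4 : N + M ^+ 2 = 0 by apply: (int_const_eq ha); rewrite -E2 E3; ring.
have N2 : N = -2 by nia.
have M2 : M * M = 2 by nia.
have [M3|[M3|M3]] : M = -1 \/ M = 0 \/ M = 1 by nia.
all: by rewrite M3 in M2.
Qed.

Lemma int_sqr_le2 (x : int) : x * x <= 2 -> x = -1 \/ x = 0 \/ x = 1.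
Proof.
move=> h; have h1 : -2 < x by nia.
have h2 : x < 2 by nia.
by dlia.
Qed.

Lemma int_mul_eqN2 (x y : int) : x * y = -2 -> 0 <= y -> x = -1 \/ x = -2.
Proof.
move=> E hy; have [y0|y1] : y = 0 \/ 1 <= y by dlia.
  by move: E; rewrite y0 mulr0.
have x0 : x < 0 by nia.
have x2 : -3 < x by nia.
by dlia.
Qed.

Lemma int_mul_eq1_sign (x y : int) : x * y = 1 -> x = 1 \/ x = -1.
Proof.
move=> E; have : x * x = 1.
  apply: (@int_mul_eq1 (x * x) (y * y)); rewrite -?expr2 ?sqr_ge0 //.
  by rewrite -exprMn E.
move=> h; have := @int_sqr_le2 x; rewrite h => /(_ isT) [->|[x0|->]]; [by right|by move: h; rewrite x0|by left].
Qed.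

(** With [D = M - N] the congruence becomes [D e = cb b - ca a]. If [D] is nonzero, either [e] is a
    multiple of [a] or {a, b, e} has an explicit type, and the resulting integer equations have no
    solution. The position -2 belongs to the regular quadruple. *)
Lemma chains_ext_ext a b c r s t e (M N k l : int) : gap a b c r s t ->
  e = ext a b c r s t -> M = 2 * k -> N = 2 * l ->
  congr c (a * M%:~R ^+ 2 + M%:~R * (a + e - b) + e)
          (b * N%:~R ^+ 2 + N%:~R * (b + e - a) + e) ->
  M = N /\ (M = 0 \/ M = -2).
Proof.
move=> G Ee Mk Nl; have [dr ds dt] := gap_degs G.
case: G => [tr ha hb hab h0 h1 h2]; rewrite -Ee => he de.
have Er := (tripleR tr).2.
move/congr_eq => /(_ ltac:(deg_tac) ltac:(deg_tac)) E.
have := triple_ext tr; rewrite -Ee => tr2.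
have ef := (tripleS tr2).2; have df := deg_root ef ha he.
pose D := M - N; pose cb := N ^+ 2 + N + M; pose ca := M ^+ 2 + M + N.
have E1 : D%:~R * e = cb%:~R * b - ca%:~R * a.
  by apply: (eq_lc (k := 1) E); rewrite /D /cb /ca; ring.
have [MN|/eqP D0] : M = N \/ D <> 0 by rewrite /D; dlia.
  split=> //; have : (b - a) * (M ^+ 2 + 2 * M)%:~R = 0.
    by apply: (eq_lc (k := -1) E); rewrite -MN; ring.
  by move/int_const_eq; rewrite subr_eq0 eq_sym => /(_ hab); nia.
exfalso.
have [hlt|heq] : (deg a < deg b)%N \/ deg a = deg b by dlia.
  have [cb0|/eqP cb0] : cb = 0 \/ cb <> 0 by dlia.
    (* Now [e] is a rational multiple of [a] and [a e + 1] is a square, so [a] and [e] are constant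
       and [deg c = deg b]. *)
    move: E1; rewrite cb0 mul0r sub0r => E1.
    have dea : (deg e <= deg a)%N by rewrite -(@deg_intM D e) // E1; deg_tac.
    have dD : deg (- (ca * D)%:~R) = 0%N by rewrite degN degZ_int.
    have [u du Eu] := const_sqrt dD.
    have [_ d0] : deg (D%:~R * (r * s - a * t)) = 0%N /\ deg (u * a) = 0%N.
      apply: (@sqr_diff_const _ _ (D ^+ 2)%:~R); rewrite ?intP_eq0 ?expf_neq0 ?degZ_int //.
      rewrite !exprMn Eu ef; apply: (eq_lc (k := D%:~R * a) E1); ring.
    have ca0 : ca != 0.
      apply/eqP => ca0; move/eqP: E1; rewrite ca0 mul0r oppr0 mulf_eq0 (negPf he) intP_eq0.
      by rewrite (negPf D0).
    have hu : u != 0 by apply: (sqr_neq0 Eu); rewrite oppr_eq0 intP_eq0 mulf_neq0.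
    by move: d0; rewrite degM //; dlia.
  have dE : deg e = deg b.
    rewrite -(@deg_intM D e) // E1 degDl deg_intM // degN.
    by deg_tac.
  have [I|[a2 II]] := triple_type tr2 ha ltac:(dlia) ltac:(dlia) ltac:(dlia).
    have [r' Hr' Er'] := type_one_root Er I.
    have dr' : deg r' = deg r by case: Hr' => ->; rewrite ?degN.
    have E2 : (cb - D)%:~R * b = 2 * D%:~R * r' + a * (ca + D)%:~R.
      by apply: (eq_lc2 (k := -1) (l := D%:~R) E1 Er'); ring.
    have E3 : cb - D = 0 by apply: (mul_int_deg_eq0 E2); deg_tac.
    have E4 : (2 * D)%:~R * r' = - a * (ca + D)%:~R.
      by apply: (eq_lc (k := -1) E2); rewrite E3; ring.
    have : 2 * D = 0 by apply: (mul_int_deg_eq0 E4); deg_tac.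
    by move/eqP: D0; dlia.
  have E2 : (cb + D)%:~R * b = a * (2 * D + ca)%:~R.
    by apply: (eq_lc2 (k := -1) (l := D%:~R) E1 II); ring.
  have da := deg_sqrN1 a2.
  have E3 : cb + D = 0 by apply: (mul_int_deg_eq0 E2); deg_tac.
  have E4 : 2 * D + ca = 0 by apply: (int_const_eq ha); rewrite -E2 E3; ring.
  rewrite /cb /ca /D in D0 E3 E4.
  (* Eliminating [N] leaves [M (M + 3)^2 = -2], whose only solution -2 has [N = M]. *)
  have EN : N = M ^+ 2 + 3 * M by dlia.
  have EM : M * (M + 3) ^+ 2 = -2.
    have : M * (M * (M + 3) ^+ 2) = M * (-2).
      by transitivity (N ^+ 2); [rewrite EN; ring|dlia].
    move/mulfI; apply; apply/eqP => M0; move/eqP: D0; rewrite EN M0; dlia.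
  have [Z|Z] := int_mul_eqN2 EM (sqr_ge0 _).
    by move: EM; rewrite Z.
  by move/eqP: D0; rewrite EN Z.
have lee : (deg e <= deg a)%N by rewrite -(@deg_intM D e) // E1; deg_tac.
have [hlt|dE] : (deg e < deg a)%N \/ deg e = deg a by dlia.
  have tr3 := triple_rot tr2.
  have [I|[e2 II]] := triple_type tr3 he ltac:(dlia) ltac:(dlia) ltac:(dlia).
    have [f' Hf Ef] := type_one_root (tripleR tr3).2 I.
    have df' : deg f' = deg (r * s - a * t) by case: Hf => ->; rewrite ?degN.
    have E2 : (cb - ca)%:~R * a = - (2 * cb%:~R * f') + e * (D - cb)%:~R.
      by apply: (eq_lc2 (k := -1) (l := - cb%:~R) E1 Ef); ring.
    have E3 : cb - ca = 0 by apply: (mul_int_deg_eq0 E2); deg_tac.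
    have E4 : (2 * cb)%:~R * f' = e * (D - cb)%:~R.
      by apply: (eq_lc (k := 1) E2); rewrite E3; ring.
    have E5 : 2 * cb = 0 by apply: (mul_int_deg_eq0 E4); deg_tac.
    have cb0 : cb = 0 by dlia.
    have : D - cb = 0 by apply: (int_const_eq he); rewrite -E4 E5; ring.
    by move/eqP: D0; dlia.
  have E2 : (cb + ca)%:~R * a = e * (2 * cb - D)%:~R.
    by apply: (eq_lc2 (k := 1) (l := cb%:~R) E1 II); ring.
  have E3 : cb + ca = 0 by apply: (mul_int_deg_eq0 E2); deg_tac.
  have E4 : 2 * cb - D = 0 by apply: (int_const_eq he); rewrite -E2 E3; ring.
  move/eqP: D0 E3 E4; rewrite /cb /ca /D => D0 E3 E4.
  have E6 : (M + 1) * (M + 1) + (N + 1) * (N + 1) = 2 by dlia.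
  have hM : 0 <= (M + 1) * (M + 1) by rewrite -expr2 sqr_ge0.
  have hN : 0 <= (N + 1) * (N + 1) by rewrite -expr2 sqr_ge0.
  have Z := @int_sqr_le2 (M + 1) ltac:(dlia); have Y := @int_sqr_le2 (N + 1) ltac:(dlia).
  have Z' : M = -2 \/ M = -1 \/ M = 0 by move: Z; clear; dlia.
  have Y' : N = -2 \/ N = -1 \/ N = 0 by move: Y; clear; dlia.
  by move: E3 E4 D0; clear -Z' Y'; case: Z' Y' => [->|[->|->]] [->|[->|->]]; dlia.
have [I|[a2 _]] := triple_type tr2 ha ltac:(dlia) ltac:(dlia) ltac:(dlia); last first.
  by have := deg_sqrN1 a2; dlia.
have [r' Hr' Er'] := type_one_root Er I.
have Er2 : r' ^+ 2 = a * b + 1 by case: Hr' => ->; rewrite ?sqrrN.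
(* The degrees of [a], [b], [e] agree. Squaring removes [r'], and completing the square in [b]
   leaves a difference of two squares with constant value. *)
pose p := N ^+ 2 + 2 * N; pose q := M ^+ 2 + 2 * M.
have E2 : 2 * D%:~R * r' = p%:~R * b - q%:~R * a.
  by apply: (eq_lc2 (k := 1) (l := - D%:~R) E1 Er'); rewrite /p /q /cb /ca /D; ring.
have E3 : (p%:~R * b - q%:~R * a) ^+ 2 = 4 * D%:~R ^+ 2 * (a * b + 1).
  by rewrite -E2 -Er2; ring.
have [p0|/eqP p0] : p = 0 \/ p <> 0 by dlia.
  have E4 : a * (q%:~R ^+ 2 * a - 4 * D%:~R ^+ 2 * b) = (4 * D ^+ 2)%:~R.
    by apply: (eq_lc (k := 1) E3); rewrite p0; ring.
  have [da _] := @mul_const a (q%:~R ^+ 2 * a - 4 * D%:~R ^+ 2 * b)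
    ltac:(rewrite E4 intP_eq0 mulf_neq0 ?expf_neq0 //) ltac:(rewrite E4 degZ_int //).
  by dlia.
(* C ^+ 2 - 4 p^2 q^2 is the square of De. *)
pose C := 2 * p * q + 4 * D ^+ 2; pose De := 4 * D * (M * N + M + N).
have E5 : (2 * p%:~R ^+ 2 * b - C%:~R * a) ^+ 2 - (De%:~R * a) ^+ 2 = (16 * p ^+ 2 * D ^+ 2)%:~R.
  apply: (eq_lc (k := 4 * p%:~R ^+ 2) E3); rewrite /C /De /p /q /D; ring.
have [_ dd] := sqr_diff_const E5
  ltac:(rewrite intP_eq0 !mulf_neq0 ?expf_neq0 //) ltac:(rewrite degZ_int //).
have De0 : De = 0.
  by apply/eqP/negPn/negP => De0; move: dd; rewrite deg_intM //; dlia.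
have : M * N + M + N = 0.
  by move/eqP: De0; rewrite /De !mulf_eq0 (negPf D0) /= => /eqP.
move=> Z; have : (M + 1) * (N + 1) = 1 by dlia.
move: D0; rewrite /D => D0 Z1; have Z2 := int_mul_eq1_sign Z1.
by move/eqP: D0; move: Z1; case: Z2 => ->; dlia.
Qed.

(** As [g^2] is 1 modulo [b], the root [g] is invertible modulo [b], and so is a nonzero integer. *)
Lemma not_dvd_root (b g h k : P) (M : int) : (0 < deg b)%N -> M != 0 ->
  g ^+ 2 = b * h + 1 -> M%:~R * g = b * k -> False.
Proof.
move=> db hM Eg E.
have E1 : b * (b * k ^+ 2 - M%:~R ^+ 2 * h) = (M ^+ 2)%:~R.
  transitivity ((b * k) ^+ 2 - M%:~R ^+ 2 * b * h); first by ring.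
  by rewrite -E exprMn Eg; ring.
have := mul_deg_eq0 E1; rewrite degZ_int => /(_ db) E2.
by move/eqP: E1; rewrite E2 mulr0 eq_sym intP_eq0 expf_eq0 (negPf hM).
Qed.

(** In [E1] the sum [M e + 2 N t] has degree at most [deg b], below [deg t], so [e] and [t] have
    equal degree. The relation is then pushed down the roots [t], [g], [g'], [v] over the pair {a,
    b} until it says that [2 M g' + 4 N b] is constant; it cannot be 0, because [g'] is invertible
    modulo [b]. *)
Lemma chains_b_zero a b c r s t e (M N : int) : gap a b c r s t ->
  e = ext a b c r s t -> N != 0 ->
  congr c (a * M%:~R ^+ 2 + M%:~R * (a + b - e) + b)
          (b * N%:~R ^+ 2 + 2 * N%:~R * t) -> False.
Proof.
move=> Gp Ee N0; have [dr ds dt] := gap_degs Gp.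
case: Gp => [tr ha hb hab h0 h1 h2]; rewrite -Ee => he de.
have [_ _ _ [_ Er] [_ Es] [_ Et]] := tr.
move/congr_eq => /(_ ltac:(deg_tac) ltac:(deg_tac)) E.
have := triple_ext tr; rewrite -Ee; set f := r * s - a * t; set g := r * t - b * s => tr2.
have [_ _ _ _ [_ Ef] [_ Eg]] := tr2.
have E1 : M%:~R * e + 2 * N%:~R * t = a * (M ^+ 2 + M)%:~R + b * (M + 1 - N ^+ 2)%:~R.
  by apply: (eq_lc (k := -1) E); ring.
have M0 : M != 0.
  apply/eqP => M0; have E2 : (2 * N)%:~R * t = b * (M + 1 - N ^+ 2)%:~R.
    by apply: (eq_lc (k := 1) E1); rewrite M0; ring.
  have : 2 * N = 0 by apply: (mul_int_deg_eq0 E2); deg_tac.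
  by move/eqP: N0; clear; dlia.
have [e1|[e1|e1]] : (deg e < deg t)%N \/ (deg t < deg e)%N \/ deg e = deg t by dlia.
- have E2 : (2 * N)%:~R * t = a * (M ^+ 2 + M)%:~R + b * (M + 1 - N ^+ 2)%:~R - M%:~R * e.
    by rewrite -E1; ring.
  have : 2 * N = 0 by apply: (mul_int_deg_eq0 E2); deg_tac.
  by move/eqP: N0; clear; dlia.
- have E2 : M%:~R * e = a * (M ^+ 2 + M)%:~R + b * (M + 1 - N ^+ 2)%:~R - 2 * N%:~R * t.
    by rewrite -E1; ring.
  by move/eqP: M0; apply; apply: (mul_int_deg_eq0 E2); deg_tac.
have hr : r != 0 by apply: deg_gt0_neq0; dlia.
have ht : t != 0 by apply: deg_gt0_neq0; dlia.
have dg := deg_root Eg hb he.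
have hg : g != 0 by apply: deg_gt0_neq0; dlia.
(* (t, g), (g, g') and (g', v) all satisfy r^2 + x^2 + y^2 - 2 r x y = 1 + b^2, whence
   the bounds on deg g' and deg v. *)
pose g' := 2 * r * g - t; pose v := 2 * r * g' - g.
have tg' : t * g' = r ^+ 2 + g ^+ 2 - 1 - b ^+ 2 by rewrite /g' /g; ring: Er Es Et.
have gv : g * v = r ^+ 2 + g' ^+ 2 - 1 - b ^+ 2 by rewrite /v /g' /g; ring: Er Es Et.
have dg' : (deg t + deg g' <= 2 * deg g)%N.
  by apply: (deg_cofactor tg' ht); [deg_tac|dlia].
have dv : (deg g + deg v <= 2 * deg b)%N by apply: (deg_cofactor gv hg); [deg_tac|dlia].
pose G := M%:~R * g + 4 * N%:~R * b * r.
have E2 : g * G = M%:~R + 2 * N%:~R * b * g'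
   + a * b * (M ^+ 2 + M)%:~R + b ^+ 2 * (M + 1 - N ^+ 2)%:~R.
  apply: (eq_lc2 (k := M%:~R) (l := b) Eg E1); rewrite /G /g'; ring.
have dG : (deg g + deg G <= 2 * deg b)%N.
  by apply: (deg_cofactor E2 hg); [deg_tac|dlia].
pose U := 2 * M%:~R * g' + 4 * N%:~R * b.
have E3 : r * U = G + M%:~R * v by rewrite /G /U /v; ring.
have tr3 := triple_ext tr2; set h := ext a b e r f g in tr3.
have gh : (- g') ^+ 2 = b * h + 1.
  by rewrite -(tripleT tr3).2 /g' /g /f sqrrN; congr (_ ^+ 2); ring: Er Es Et.
rewrite sqrrN in gh.
have [a0|a0] := posnP (deg a); last first.
  have U0 : U = 0 by apply: (mul_deg_eq0 E3); deg_tac.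
  apply: (@not_dvd_root b g' h (- 4 * N%:~R) (2 * M)) => //; first by rewrite mulf_neq0.
  by apply: (eq_lc (k := 1) U0); rewrite /U; ring.
(* For a constant [a] the count only gives degree 0. Then {a, b, h} has an explicit type, and [g']
   is [± (b + r')] or [± a (b - a)]. *)
have dU : deg U = 0%N.
  apply/eqP; have [->|hU] := eqVneq U 0; first by rewrite deg0.
  have : (deg (r * U) <= deg r)%N by rewrite E3; deg_tac.
  by rewrite degM //; dlia.
have dgb : deg g' = deg b.
  rewrite -(@deg_intM (2 * M)) ?mulf_neq0 //.
  have -> : (2 * M)%:~R * g' = U + (- 4 * N)%:~R * b by rewrite /U; ring.
  by rewrite degDr deg_intM ?mulf_neq0 //; dlia.
have hh : h != 0.
  by apply/eqP => hh; have := deg_sqr g'; rewrite gh hh mulr0 add0r deg1; dlia.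
have dh := deg_root gh hb hh.
have [I|[a2 II]] := triple_type tr3 ha ltac:(dlia) ltac:(dlia) ltac:(dlia).
  have [r' Hr' Eh] := type_one_root Er I.
  have dr' : deg r' = deg r by case: Hr' => ->; rewrite ?degN.
  have Er2 : r' ^+ 2 = a * b + 1 by case: Hr' => ->; rewrite ?sqrrN.
  have : g' ^+ 2 = (b + r') ^+ 2 by rewrite gh Eh; ring: Er2.
  case/sqrf_eq => Eg'.
    have [] : 2 * M + 4 * N = 0 /\ 2 * M = 0; last by move/eqP: M0; clear; dlia.
    apply: (@lincomb_sqrt_eq0 b r' U); [dlia|dlia|exact: dU|].
    by rewrite /U Eg'; ring.
  have [] : - 2 * M + 4 * N = 0 /\ - 2 * M = 0; last by move/eqP: M0; clear; dlia.
  apply: (@lincomb_sqrt_eq0 b r' U); [dlia|dlia|exact: dU|].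
  by rewrite /U Eg'; ring.
have : g' ^+ 2 = (a * (b - a)) ^+ 2.
  by rewrite gh II exprMn a2; ring: a2.
have key : forall m : int, 2 * m%:~R * a + 4 * N%:~R = 0 -> False.
  move=> m Em; have [_] : 2 * m = 0 /\ - 4 * N = 0; last by move/eqP: N0; clear; dlia.
  by apply: (sqr_sum_a a2); apply: (eq_lc (k := 1) Em); ring.
case/sqrf_eq => Eg'.
  apply: (key M); apply: (@mul_deg_eq0 _ b (U + 2 * M%:~R * a ^+ 2)).
    by rewrite /U Eg'; ring.
  by deg_tac.
apply: (key (- M)); apply: (@mul_deg_eq0 _ b (U - 2 * M%:~R * a ^+ 2)).
  by rewrite /U Eg'; ring.
by deg_tac.
Qed.

Lemma quadratic_coeffs_eq0 (r p q k : P) : (0 < deg r)%N ->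
  deg p = 0%N -> deg q = 0%N -> deg k = 0%N -> p * r ^+ 2 + q * r + k = 0 ->
  [/\ p = 0, q = 0 & k = 0].
Proof.
move=> dr dp dq dk E.
have E1 : r * (p * r + q) = - k by apply: (eq_lc (k := 1) E); ring.
have E2 : p * r + q = 0 by apply: (mul_deg_eq0 E1); rewrite degN; dlia.
have E3 : r * p = - q by apply: (eq_lc (k := 1) E2); ring.
have p0 : p = 0 by apply: (mul_deg_eq0 E3); rewrite degN; dlia.
have q0 : q = 0 by rewrite -E2 p0; ring.
by split=> //; rewrite -E p0 q0; ring.
Qed.

(** For positive [N] the right-hand side lies strictly between [N^2] and [(N + 1)^2]; the
    substitution of [- N - 1] for [N] covers the negative values. *)
Lemma int_sqr_between (M N : int) : M ^+ 2 = N ^+ 2 + N + 1 -> N = 0 \/ N = -1.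
Proof.
wlog hM : M / 0 <= M.
  by move=> W; have [|h] := leP 0 M; [apply: W|rewrite -sqrrN; apply: W; dlia].
wlog hN : N / 0 <= N.
  move=> W E; have [|h] := leP 0 N; first by move/W; apply.
  by have := W (- N - 1); rewrite E => /(_ ltac:(dlia) ltac:(ring)); dlia.
move=> E; have [|h1] := leP N 0; first by left; dlia.
have h2 : N < M by nia.
have h3 : M < N + 1 by nia.
dlia.
Qed.

Lemma triple_swap12 a b c r s t : triple a b c r s t -> triple b a c r t s.
Proof. by case=> *; split=> //; apply: root_ofC. Qed.

Lemma triple_swap23 a b c r s t : triple a b c r s t -> triple a c b s r t.
Proof. by case=> *; split=> //; apply: root_ofC. Qed.

(** By parity the coefficients of [e], [s] and [b] in [E1] are nonzero, so the largest of the three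
    degrees is attained at least twice. When [s] attains it with just one of the others, the
    relation is pushed down to smaller roots; when all three agree, [a] is constant and everything
    becomes a polynomial in [r]. *)
Lemma chains_zero_a a b c r s t e (M N k l : int) : gap a b c r s t ->
  e = ext a b c r s t -> M = 2 * k + 1 -> N = 2 * l -> N != 0 ->
  congr c (a * M%:~R ^+ 2 + 2 * M%:~R * s)
          (b * N%:~R ^+ 2 + N%:~R * (a + b - e) + a) -> False.
Proof.
move=> Gp Ee Mk Nl N0; have [dr ds dt] := gap_degs Gp.
case: Gp => [tr ha hb hab h0 h1 h2]; rewrite -Ee => he de.
have [_ _ _ [_ Er] [_ Es] [_ Et]] := tr.
move/congr_eq => /(_ ltac:(deg_tac) ltac:(deg_tac)) E.
have := triple_ext tr; rewrite -Ee; set f := r * s - a * t; set g := r * t - b * s => tr2.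
have [_ _ _ _ [_ Ef] [_ Eg]] := tr2.
have M0 : M != 0 by apply/eqP; dlia.
pose L := N ^+ 2 + N.
have L0 : L != 0 by apply/eqP; rewrite /L; move/eqP: N0; rewrite Nl; clear; nia.
have E1 : N%:~R * e + 2 * M%:~R * s = b * L%:~R + a * (N + 1 - M ^+ 2)%:~R.
  by apply: (eq_lc (k := 1) E); rewrite /L; ring.
have df := deg_root Ef ha he.
have hr : r != 0 by apply: deg_gt0_neq0; dlia.
have hs : s != 0 by apply: deg_gt0_neq0; dlia.
have tr3 := triple_ext tr2; pose h := ext a b e r f g; rewrite -/h in tr3.
(* The root other than [s] of [x^2 - 2 r f x + r^2 + f^2 = 1 + a^2]. *)
pose h' := 2 * r * f - s.
have gh : h' ^+ 2 = a * h + 1.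
  by rewrite -(tripleS tr3).2 /h' /g /f; congr (_ ^+ 2); ring: Er Es Et.
have sh' : s * h' = r ^+ 2 + f ^+ 2 - 1 - a ^+ 2 by rewrite /h' /f; ring: Er Es Et.
have E2 : N%:~R * f ^+ 2 + 4 * M%:~R * a * r * f - L%:~R * r ^+ 2 =
   2 * M%:~R * a * h' + a ^+ 2 * (N + 1 - M ^+ 2)%:~R - (N ^+ 2)%:~R.
  rewrite Ef Er; apply: (eq_lc (k := a) E1); rewrite /h' /L; ring.
have [e1|[e1|e1]] : (deg b < deg e)%N \/ (deg e < deg b)%N \/ deg e = deg b by dlia.
- have [e2|[e2|e2]] : (deg e < deg s)%N \/ (deg s < deg e)%N \/ deg e = deg s by dlia.
  + have E3 : (2 * M)%:~R * s = b * L%:~R + a * (N + 1 - M ^+ 2)%:~R - N%:~R * e.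
      by rewrite -E1; ring.
    have : 2 * M = 0 by apply: (mul_int_deg_eq0 E3); deg_tac.
    by move/eqP: M0; clear; dlia.
  + have E3 : N%:~R * e = b * L%:~R + a * (N + 1 - M ^+ 2)%:~R - 2 * M%:~R * s.
      by rewrite -E1; ring.
    by move/eqP: N0; apply; apply: (mul_int_deg_eq0 E3); deg_tac.
  have hf : f != 0 by apply: deg_gt0_neq0; dlia.
  pose v := 2 * r * h' - f.
  have fv : f * v = r ^+ 2 + h' ^+ 2 - 1 - a ^+ 2.
    by rewrite /v /h' /f; ring: Er Es Et.
  have dh' : (deg s + deg h' <= 2 * deg f)%N by apply: (deg_cofactor sh' hs); [deg_tac|dlia].
  have dv : (deg f + deg v <= maxn (2 * deg r) (2 * deg a))%N.
    by apply: (deg_cofactor fv hf); [deg_tac|dlia].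
  pose G := N%:~R * f + 4 * M%:~R * a * r.
  have E3 : f * G = L%:~R * r ^+ 2 + 2 * M%:~R * a * h' + a ^+ 2 * (N + 1 - M ^+ 2)%:~R
     - (N ^+ 2)%:~R by apply: (eq_lc (k := 1) E2); rewrite /G; ring.
  have dG : (deg f + deg G <= maxn (2 * deg r) (2 * deg a))%N.
    by apply: (deg_cofactor E3 hf); [deg_tac|dlia].
  pose U := 2 * N%:~R * h' + 4 * M%:~R * a.
  have E4 : r * U = G + N%:~R * v by rewrite /U /G /v; ring.
  have U0 : U = 0 by apply: (mul_deg_eq0 E4); deg_tac.
  apply: (@not_dvd_root a h' h (- 4 * M%:~R) (2 * N)) => //; [dlia|by rewrite mulf_neq0|].
  by apply: (eq_lc (k := 1) U0); rewrite /U; ring.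
- have [e2|[e2|e2]] : (deg b < deg s)%N \/ (deg s < deg b)%N \/ deg b = deg s by dlia.
  + have E3 : (2 * M)%:~R * s = b * L%:~R + a * (N + 1 - M ^+ 2)%:~R - N%:~R * e.
      by rewrite -E1; ring.
    have : 2 * M = 0 by apply: (mul_int_deg_eq0 E3); deg_tac.
    by move/eqP: M0; clear; dlia.
  + have E3 : L%:~R * b = N%:~R * e + 2 * M%:~R * s - a * (N + 1 - M ^+ 2)%:~R.
      by rewrite E1; ring.
    by move/eqP: L0; apply; apply: (mul_int_deg_eq0 E3); deg_tac.
  have a0 : (0 < deg a)%N by dlia.
  have hf : f != 0 by apply: deg_gt0_neq0; dlia.
  (* Compared with the previous case, [r] and [f] exchange their roles. *)
  pose v := 2 * f * h' - r.
  have rv : r * v = f ^+ 2 + h' ^+ 2 - 1 - a ^+ 2.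
    by rewrite /v /h' /f; ring: Er Es Et.
  have dh' : (deg s + deg h' <= 2 * deg r)%N by apply: (deg_cofactor sh' hs); [deg_tac|dlia].
  have dv : (deg r + deg v <= maxn (2 * deg f) (2 * deg a))%N.
    by apply: (deg_cofactor rv hr); [deg_tac|]; dlia.
  pose G := - L%:~R * r + 4 * M%:~R * a * f.
  have E3 : r * G = 2 * M%:~R * a * h' - N%:~R * f ^+ 2 + a ^+ 2 * (N + 1 - M ^+ 2)%:~R
     - (N ^+ 2)%:~R by apply: (eq_lc (k := 1) E2); rewrite /G; ring.
  pose U := - 2 * L%:~R * h' + 4 * M%:~R * a.
  have U0 : U != 0.
    apply/eqP => U0; apply: (@not_dvd_root a h' h (4 * M%:~R) (2 * L)) => //.
      by rewrite mulf_neq0.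
    by apply: (eq_lc (k := -1) U0); rewrite /U; ring.
  have E4 : r * (f * U) = (2 * M%:~R * a * h' - N%:~R * f ^+ 2 + a ^+ 2 * (N + 1 - M ^+ 2)%:~R
     - (N ^+ 2)%:~R) - L%:~R * (f ^+ 2 + h' ^+ 2 - 1 - a ^+ 2).
    by rewrite -E3 -rv /U /G /v; ring.
  have D4 : (deg r + (deg f + deg U) <= maxn (2 * deg f) (2 * deg a))%N.
    by rewrite -degM // -degM ?mulf_neq0 // E4; deg_tac.
  (* The bound [D4] has no slack, since [deg r + deg f = 2 deg a + deg e]. *)
  have [eb0 dU] : deg e = 0%N /\ deg U = 0%N by dlia.
  have dha : deg h' = deg a.
    rewrite -(@deg_intM (2 * L)) ?mulf_neq0 //.
    have -> : (2 * L)%:~R * h' = - U + (4 * M)%:~R * a by rewrite /U; ring.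
    by rewrite degDr deg_intM ?mulf_neq0 // degN; dlia.
  have hh : h != 0.
    by apply/eqP => hh; have := deg_sqr h'; rewrite gh hh mulr0 add0r deg1; dlia.
  have dh := deg_root gh ha hh.
  have Eh : h = ext a e b f r g by rewrite /h /ext; ring.
  have tr4 := triple_ext (triple_swap23 tr2); rewrite -Eh in tr4.
  have [I|[a2 II]] := triple_type (triple_swap12 tr4) he ltac:(dlia) ltac:(dlia) ltac:(dlia).
    have [f' Hf' Eh'] := type_one_root (tripleR (triple_swap12 tr4)).2 I.
    have df' : deg f' = deg f by case: Hf' => ->; rewrite ?degN.
    have Ef2 : f' ^+ 2 = a * e + 1 by case: Hf' => ->; rewrite ?sqrrN.
    have : h' ^+ 2 = (a + f') ^+ 2 by rewrite gh Eh'; ring: Ef2.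
    case/sqrf_eq => Eg'.
      have [] : - 2 * L + 4 * M = 0 /\ - 2 * L = 0; last by move/eqP: L0; clear; dlia.
      apply: (@lincomb_sqrt_eq0 a f' U); [dlia|dlia|exact: dU|].
      by rewrite /U Eg'; ring.
    have [] : 2 * L + 4 * M = 0 /\ 2 * L = 0; last by move/eqP: L0; clear; dlia.
    apply: (@lincomb_sqrt_eq0 a f' U); [dlia|dlia|exact: dU|].
    by rewrite /U Eg'; ring.
  have : h' ^+ 2 = (e * (a - e)) ^+ 2 by rewrite gh II exprMn; ring: a2.
  have key : forall m : int, - 2 * m%:~R * e + 4 * M%:~R = 0 -> False.
    move=> m Em; have [_] : - 2 * m = 0 /\ - 4 * M = 0; last by move/eqP: M0; clear; dlia.
    by apply: (sqr_sum_a a2); apply: (eq_lc (k := 1) Em); ring.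
  case/sqrf_eq => Eg'.
    apply: (key L); apply: (@mul_deg_eq0 _ a (U - 2 * L%:~R * e ^+ 2)); last by deg_tac.
    by rewrite /U Eg'; ring.
  apply: (key (- L)); apply: (@mul_deg_eq0 _ a (U + 2 * L%:~R * e ^+ 2)); last by deg_tac.
  by rewrite /U Eg'; ring.
have a0 : deg a = 0%N.
  apply/eqP; rewrite eqn0Ngt; apply/negP => a0.
  have E3 : (2 * M)%:~R * s = b * L%:~R + a * (N + 1 - M ^+ 2)%:~R - N%:~R * e.
    by rewrite -E1; ring.
  have : 2 * M = 0 by apply: (mul_int_deg_eq0 E3); deg_tac.
  by move/eqP: M0; clear; dlia.
(* The same quadratic equation with the square completed in [s]. The type of {a, b, e} makes [f],
   hence [s], explicit in [r], and [E3] can be compared coefficient by coefficient. *)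
have Esf : (s - r * f) ^+ 2 = (r ^+ 2 - 1) * (f ^+ 2 - 1) + a ^+ 2.
  by rewrite /f; ring: Er Es Et.
have E3 : N%:~R * (f ^+ 2 - 1) + 2 * M%:~R * a * s =
    L%:~R * (r ^+ 2 - 1) + a ^+ 2 * (N + 1 - M ^+ 2)%:~R.
  by rewrite Ef Er; apply: (eq_lc (k := a) E1); ring.
have dr0 : (0 < deg r)%N by dlia.
have [I|[a2 II]] := triple_type tr2 ha ltac:(dlia) ltac:(dlia) ltac:(dlia); last first.
  have Ef' : f ^+ 2 = - r ^+ 2 by rewrite Ef II Er; ring: a2.
  have [eta Eeta] : exists eta : int, s = 2 * eta%:~R * a * r ^+ 2.
    have : f ^+ 2 = (a * r) ^+ 2 by rewrite Ef' exprMn a2; ring.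
    have : (s - r * f) ^+ 2 = (a * r ^+ 2) ^+ 2.
      by rewrite Esf Ef' exprMn a2; ring: a2.
    move=> /sqrf_eq[] Hs /sqrf_eq[] Hf; rewrite Hf in Hs.
    - by exists 1; apply: (eq_lc (k := 1) Hs); ring.
    - by move: hs; rewrite (_ : s = 0) ?eqxx //; apply: (eq_lc (k := 1) Hs); ring.
    - by move: hs; rewrite (_ : s = 0) ?eqxx //; apply: (eq_lc (k := 1) Hs); ring.
    - by exists (-1); apply: (eq_lc (k := 1) Hs); ring.
  have [_ _ /eqP] : [/\ (- N - 4 * M * eta - L)%:~R = 0 :> P, 0 = 0 :> P &
      (L + 1 - M ^+ 2)%:~R = 0 :> P].
    apply: (@quadratic_coeffs_eq0 r); rewrite ?deg0 ?degZ_int //.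
    by apply: (eq_lc (k := 1) E3); rewrite Eeta Ef'; ring: a2.
  rewrite intP_eq0 /L => /eqP Z; have := @int_sqr_between M N.
  by move/eqP: N0; rewrite Nl in Z *; clear -Z; dlia.
have [r' Hr' Ee'] := type_one_root Er I.
have dr' : deg r' = deg r by case: Hr' => ->; rewrite ?degN.
have Er2 : r' ^+ 2 = r ^+ 2 by case: Hr' => ->; rewrite ?sqrrN.
have [eta eta1 Eeta] : exists2 eta : int, eta ^+ 2 = 1 &
    s = eta%:~R * (2 * r' ^+ 2 + 2 * a * r' - 1).
  have : f ^+ 2 = (a + r') ^+ 2 by rewrite Ef Ee'; ring: Er2 Er.
  have : (s - r * f) ^+ 2 = (r ^+ 2 + a * r' - 1) ^+ 2.
    by rewrite Esf Ef Ee'; ring: Er2 Er.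
  have kill : forall p : P, deg p = 0%N -> s = p ->
    exists2 eta : int, eta ^+ 2 = 1 & s = eta%:~R * (2 * r' ^+ 2 + 2 * a * r' - 1).
    move=> p dp sp; have : deg s = deg p by rewrite sp.
    by dlia.
  move=> /sqrf_eq[] Hs /sqrf_eq[] Hf; rewrite Hf in Hs; case: Hr' => Hr'; subst r'.
  all: try by exists 1 => //; apply: (eq_lc (k := 1) Hs); ring.
  all: try by exists (-1) => //; apply: (eq_lc (k := 1) Hs); ring.
  all: try by apply: (kill 1); rewrite ?deg1 //; apply: (eq_lc (k := 1) Hs); ring.
  all: try by apply: (kill (-1)); rewrite ?degN ?deg1 //; apply: (eq_lc (k := 1) Hs); ring.
(* The coefficients of [r'^2], [r'] and 1. They force [N = -2], then [a^2 = 3] and [3 M^2 = 1]. *)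
have [C1 C2 C3] : [/\ N%:~R + 4 * M%:~R * a * eta%:~R - L%:~R = 0,
    2 * N%:~R * a + 4 * M%:~R * a ^+ 2 * eta%:~R = 0 &
    N%:~R * (a ^+ 2 - 1) - 2 * M%:~R * a * eta%:~R + L%:~R
      - a ^+ 2 * (N + 1 - M ^+ 2)%:~R = 0].
  apply: (@quadratic_coeffs_eq0 r'); try by apply/eqP; rewrite -leqn0; deg_tac.
    by rewrite dr'.
  have Ef' : f ^+ 2 = (a + r') ^+ 2 by rewrite Ef Ee'; ring: Er2 Er.
  by apply: (eq_lc (k := 1) E3); rewrite Eeta Ef' -Er2; ring.
have C4 : N%:~R + 2 * M%:~R * a * eta%:~R = 0.
  apply/eqP; have : 2 * a * (N%:~R + 2 * M%:~R * a * eta%:~R) == 0.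
    by apply/eqP; rewrite -C2; ring.
  by rewrite !mulf_eq0 (negPf ha) (negPf (nat_neq0P 1)).
have N2 : N = -2.
  have /eqP : (N ^+ 2 + 2 * N)%:~R = 0 :> P.
    by apply: (eq_lc2 (k := -1) (l := 2) C1 C4); rewrite /L; ring.
  by rewrite intP_eq0; move/eqP: N0; clear; nia.
have C5 : M%:~R * a * eta%:~R = 1.
  apply/eqP; have : 2 * (M%:~R * a * eta%:~R - 1) == 0.
    by apply/eqP; rewrite -C4 N2; ring.
  by rewrite mulf_eq0 (negPf (nat_neq0P 1)) /= subr_eq0.
have C6 : M%:~R ^+ 2 * a ^+ 2 = 1.
  have : (M%:~R * a * eta%:~R) ^+ 2 = 1 by rewrite C5 expr1n.
  by rewrite !exprMn -[eta%:~R ^+ 2]rmorphXn /= eta1 mulr1.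
have C7 : M%:~R ^+ 2 * a ^+ 2 - a ^+ 2 + 2 = 0.
  by apply: (eq_lc2 (k := 1) (l := 2) C3 C5); rewrite /L N2; ring.
have C8 : a ^+ 2 = 3 by apply: (eq_lc2 (k := -1) (l := 1) C7 C6); ring.
have : (3 * M ^+ 2 - 1)%:~R == 0 :> P.
  by apply/eqP; apply: (eq_lc (k := 1) C6); rewrite C8; ring.
by rewrite intP_eq0; clear; dlia.
Qed.

(** * Quadruples over a triple with a dominant element *)

(** The starting point determines the product of its two roots only up to sign. Given any roots
    [X0], [Z0], the sign is moved into the position, which becomes the signed integer [e * n]; [q]
    is the known residue of the linear coefficient. *)
Lemma chain_formula a c s w n v X0 Z0 q : s ^+ 2 = a * c + 1 -> sol a c w ->
  v = iter n (up a c s) w ->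
  X0 ^+ 2 = a * w.1.1 + 1 -> Z0 ^+ 2 = c * w.1.1 + 1 -> congr c (2 * s * X0 * Z0) q ->
  exists e : int, [/\ e = 1 \/ e = -1, w.1.2 * w.2 = e%:~R * (X0 * Z0) &
    congr c v.1.1 (a * (e * n%:Z)%:~R ^+ 2 + (e * n%:Z)%:~R * q + w.1.1)].
Proof.
move=> Es hw -> EX EZ [k Ek]; have [/= [l El] _ _ _] := chain_congr n Es hw.
have [_ [_ Ex] [_ Ez]] := hw.
have [e He Ee] : exists2 e : int, e = 1 \/ e = -1 & w.1.2 * w.2 = e%:~R * (X0 * Z0).
  have /sqrf_eq[] : (w.1.2 * w.2) ^+ 2 = (X0 * Z0) ^+ 2 by rewrite !exprMn Ex Ez EX EZ.
    by exists 1; [left|rewrite mul1r].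
  by exists (-1); [right|rewrite rmorphN mulN1r].
have e2 : e%:~R ^+ 2 = 1 :> P by case: He => ->; ring.
exists e; split=> //; exists (l + (e * n%:Z)%:~R * k); rewrite El.
have -> : 2 * n%:R * (s * w.1.2 * w.2) = 2 * n%:R * s * (w.1.2 * w.2) by ring.
by apply: (eq_lc2 (k := 2 * n%:R * s) (l := (e * n%:Z)%:~R) Ee Ek); ring: e2.
Qed.

(** This is how every surviving case ends: [d] is one step above [b] in the (a, c)-chain. *)
Lemma up_regular a b c s v : s ^+ 2 = a * c + 1 -> sol a c v -> v.1.1 = b ->
  regular a b c (up a c s v).1.1.
Proof.
move=> Es [_ [_ Ex] [_ Ez]] Eb; rewrite /regular /up /= -Es.
rewrite (_ : a * b + 1 = v.1.2 ^+ 2) ?Ex ?Eb //.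
rewrite (_ : b * c + 1 = v.2 ^+ 2); last by rewrite Ez Eb; ring.
by rewrite -Eb -Ex; ring.
Qed.

Lemma iter_down a c s w n : s ^+ 2 = a * c + 1 -> sol a c w ->
  iter n (up a c s) w = iter n.+1 (up a c s) (down a c s w).
Proof. by move=> Es hw; rewrite iterSr up_down. Qed.

(* Going one step further down makes the position even, unless this is blocked by a zero
   or a constant base. *)
Lemma descent_even a c s d x z : halfGauss a -> halfGauss c -> root_of s a c ->
  a != 0 -> (deg a < deg c)%N -> sol a c (d, x, z) -> (deg c <= deg z)%N ->
  exists x' n w, [/\ x' = x \/ x' = - x, sol a c w, (d, x', z) = iter n (up a c s) w,
    (deg w.2 < deg c)%N & (0 < n)%N] /\
   [\/ ~~ odd n, odd n /\ w.1.1 = 0 | [/\ odd n, a ^+ 2 = -1, w.1.1 = a & w.1.2 = 0]].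
Proof.
move=> ha hc hs a0 dac hv dz; have Es := hs.2.
have dc : (0 < deg c)%N by dlia.
have [_ ds] := deg_s_gt0 Es a0 dc.
have [x' [n [w [Hx' hw Ew dw Hn]]]] :=
  @descent a c s (deg c).-1 ha hc hs a0 dc (ltnW dac) ltac:(dlia) d x z hv.
have n0 : (0 < n)%N.
  by case: n Ew {Hn} => // Ew; move: dw; rewrite -[w]/(iter 0 (up a c s) w) -Ew /=; dlia.
have {Hn} [d1 _] := Hn n0.
have dw' : (deg w.2 < deg c)%N by dlia.
case On: (odd n); last first.
  by exists x', n, w; split=> //; constructor 1; rewrite On.
have [D0|D0] := eqVneq w.1.1 0.
  by exists x', n, w; split=> //; constructor 2.
have [hD [hX Ex] [_ Ez]] := hw.
have dZ := deg_root Ez (deg_gt0_neq0 dc) D0.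
(* Two constants extending the nonconstant [c] coincide. Otherwise [deg s + deg w.2] exceeds
   [deg c], the step up is the larger neighbour, and the extra step down stays below [deg c]. *)
have [/andP[/eqP da /eqP dD]|big] := boolP ((deg a == 0%N) && (deg w.1.1 == 0%N)).
  have Ea : a = w.1.1 by apply: (@two_const _ _ c s w.2); rewrite // Ez mulrC.
  have E1 : a ^+ 2 + 1 = w.1.2 ^+ 2 by rewrite Ex -Ea.
  case: (halfGauss_const_unit ha hX E1 da) => [E0|E0]; first by rewrite E0 eqxx in a0.
  exists x', n, w; split=> //; constructor 3; split=> //.
  by apply: (eq_lc (k := 1) E1); rewrite E0; ring.
have {}big : (0 < deg a + deg w.1.1)%N by move: big; clear; lia.
have hw3 : sol a c (w.1.1, w.1.2, w.2) by case: (w) hw => [[]].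
have [u0 v0 h1 h2 _] := neighbour_degs ha hc hs a0 dc (ltnW dac) hw3.
have Eup : (up a c s w).2 = s * w.2 + c * w.1.2 by [].
rewrite Eup in d1.
exists x', n.+1, (down a c s w); split.
  split=> //; [exact: sol_down|by rewrite -iter_down|].
  have -> : (down a c s w).2 = s * w.2 - c * w.1.2 by [].
  by dlia.
by constructor 1; rewrite /= On.
Qed.

Lemma sol_zero a c w : sol a c w -> w.1.1 = 0 ->
  1 ^+ 2 = a * w.1.1 + 1 /\ 1 ^+ 2 = c * w.1.1 + 1.
Proof. by move=> _ ->; rewrite !mulr0 add0r expr1n. Qed.

Record quad (a b c d r s t x y z : P) : Prop := Quad {
  quadT : triple a b c r s t;
  quadD : halfGauss d;
  quadX : root_of x a d; quadY : root_of y b d; quadZ : root_of z c d;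
  quad_neq0 : [/\ a != 0, b != 0, c != 0 & d != 0];
  quad_neq3 : [/\ a != b, a != c & b != c];
  quad_neqd : [/\ a != d, b != d & c != d] }.

Lemma signed_even (e : int) n : ~~ odd n -> exists k, e * n%:Z = 2 * k.
Proof.
move=> h; exists (e * (n./2)%:Z).
have En : n%:Z = 2 * (n./2)%:Z.
  by have := odd_double_half n; rewrite (negPf h) -muln2; dlia.
by rewrite En; ring.
Qed.

Lemma signed_odd (e : int) n : e = 1 \/ e = -1 -> odd n -> exists k, e * n%:Z = 2 * k + 1.
Proof.
move=> He h; have En : n%:Z = 2 * (n./2)%:Z + 1.
  by have := odd_double_half n; rewrite h -muln2; dlia.
by case: He => ->; [exists (n./2)%:Z|exists (- (n./2)%:Z - 1)]; rewrite En; ring.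
Qed.

Lemma signed_neq0 (e : int) n : e = 1 \/ e = -1 -> (0 < n)%N -> e * n%:Z != 0.
Proof. by move=> He hn; rewrite mulf_neq0 //; [case: He => ->|dlia]. Qed.

Lemma no_self_extension (b y : P) : (0 < deg b)%N -> y ^+ 2 = b * b + 1 -> False.
Proof.
move=> db E; have E1 : y ^+ 2 = 1 * b ^+ 2 + 1 by rewrite E; ring.
by have := sqr_multiple_const deg1 (oner_neq0 _) E1; dlia.
Qed.

(** Equal residues of [z] identify the starting points. For even positions they coincide: 0, or [a]
    with [a^2 = -1], or an extension of the whole triple, which induction identifies with [e]. An
    odd position replaces the root of the starting point by a multiple of [s] or [t] and pairs 0
    with [a], or [b] with 0. *)
Lemma case_gap a b c d r s t x y z : gap a b c r s t -> quad a b c d r s t x y z ->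
  (deg c < deg d)%N ->
  (forall D X Y Z, quad a b c D r s t X Y Z -> (deg D < deg c)%N -> regular a b c D) ->
  regular a b c d.
Proof.
move=> G Q hcd IH; have [dr ds dt] := gap_degs G.
have [tr ha hb hab h0 h1 h2 he de] := G.
have [_ hd hx hy hz [_ _ hc d0] [_ hac hbc] [had hbd hcdn]] := Q.
have [gA gB gC [_ Er] [gs Es] [gt Et]] := tr.
pose e := ext a b c r s t; rewrite -/e in he de.
(* By definition of [e], [2 r s t = a + b + c + 2 a b c - e]. *)
have q1 : congr c (2 * s * r * t) (a + b - e).
  by exists (1 + 2 * a * b); rewrite /e /ext; ring.
have q2 : congr c (2 * t * r * s) (a + b - e).
  by exists (1 + 2 * a * b); rewrite /e /ext; ring.
have dz := deg_root hz.2 hc d0.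
have solA : sol a c (d, x, z) by [].
have solB : sol b c (d, y, z) by [].
have rT : root_of t b c by [].
have [x' [n [w [[_ hw Ew dw n0] sideA]]]] :=
  @descent_even a c s d x z gA gC (conj gs Es) ha ltac:(dlia) solA ltac:(dlia).
have [y' [m [w' [[_ hw' Ew' dw' m0] sideB]]]] :=
  @descent_even b c t d y z gB gC (conj gt Et) hb ltac:(dlia) solB ltac:(dlia).
have [_ _ CA _] := chain_congr n Es hw; have [_ _ CB _] := chain_congr m Et hw'.
rewrite -Ew /= in CA; rewrite -Ew' /= in CB.
have CC := congr_trans (congr_sym CA) CB.
have [_ [_ Exw] [_ Ezw]] := hw; have [_ [_ Eyw] [_ Ezw']] := hw'.
have inj : forall u v : P, c * u + 1 = c * v + 1 -> u = v.
  by move=> u v /addIr /(mulfI hc).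
case: sideB => [Om|[Om D0']|[_ b2 _ _]]; last by have := deg_sqrN1 b2; dlia.
  rewrite (negPf Om) in CC.
  case: sideA => [On|[On D0]|[On a2 Da X0]].
  - rewrite (negPf On) in CC.
    have Zw : w.2 = w'.2 by apply: congr_eq CC.
    have Dw : w.1.1 = w'.1.1 by apply: inj; rewrite -Ezw Zw Ezw'.
    have [D0|D0] := eqVneq w.1.1 0.
      have D0' : w'.1.1 = 0 by rewrite -Dw.
      have [eA [HA _ FA]] := chain_formula Es hw Ew (sol_zero hw D0).1 (sol_zero hw D0).2
        (congr_refl _ _).
      have [eB [HB _ FB]] := chain_formula Et hw' Ew' (sol_zero hw' D0').1 (sol_zero hw' D0').2
        (congr_refl _ _).
      exfalso; have [] := @chains_zero_zero a b c r s t (eA * n%:Z) (eB * m%:Z) G.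
        apply: congr_trans (congr_trans (congr_sym _) FB) _; last by exists 0; rewrite D0'; ring.
        by apply: congr_trans FA _; exists 0; rewrite D0; ring.
      by move=> M0; move: (signed_neq0 HA n0); rewrite M0.
    have [Da|Da] := eqVneq w.1.1 a.
      have Da' : w'.1.1 = a by rewrite -Dw.
      have da : deg a = 0%N.
        apply/eqP; rewrite eqn0Ngt; apply/negP => da.
        by apply: (no_self_extension da (y := w.1.2)); rewrite Exw Da.
      have E1 : a ^+ 2 + 1 = w.1.2 ^+ 2 by rewrite Exw Da.
      have [_ [hX _] _] := hw.
      case: (halfGauss_const_unit gA hX E1 da) => [E0|X0]; first by rewrite E0 eqxx in ha.
      have a2 : a ^+ 2 = -1 by apply: (eq_lc (k := 1) E1); rewrite X0; ring.
      have [eA [HA _ FA]] := chain_formula Es hw Ew (X0 := 0) (Z0 := s) (q := 0)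
        ltac:(rewrite Da -expr2 a2; ring) ltac:(rewrite Da Es; ring) ltac:(exists 0; ring).
      have [eB [HB _ FB]] := chain_formula Et hw' Ew' (X0 := r) (Z0 := s)
        ltac:(rewrite Da' Er; ring) ltac:(rewrite Da' Es; ring) q2.
      have [k Ek] := signed_even eB Om.
      exfalso; apply: (@chains_self_self a b c r s t e (eA * n%:Z) (eB * m%:Z) k G erefl a2 Ek).
        exact: signed_neq0.
      apply: congr_trans (congr_trans (congr_sym _) FB) _; last by exists 0; rewrite Da'; ring.
      by apply: congr_trans FA _; exists 0; rewrite Da; ring.
    have [Db|Db] := eqVneq w.1.1 b.
      by exfalso; apply: (no_self_extension h2 (y := w'.1.2)); rewrite Eyw -Dw Db.
    have dDc : (deg w.1.1 < deg c)%N by move: dw (deg_root Ezw hc D0); clear; dlia.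
    have [Dc|Dc] := eqVneq w.1.1 c; first by rewrite Dc ltnn in dDc.
    have QD : quad a b c w.1.1 r s t w.1.2 w'.1.2 w.2.
      case: hw => hwD hwX hwZ; case: hw' => _ hwY _.
      by split=> //; [rewrite Dw|split; rewrite // eq_sym].
    have [t' tr' [ED Ht']] := regular_ext tr (IH _ _ _ _ QD dDc).
    (* The other regular extension is too large: the sum of the two has degree
       [deg a + deg b + deg c]. *)
    have De : w.1.1 = e.
      case: Ht' => Ht'; first by rewrite ED Ht'.
      have := @deg_ext_add a b c r s t ha hb ltac:(dlia) ltac:(dlia) ltac:(dlia) ltac:(dlia).
      rewrite -Ht' -ED -/e => S.
      have : (deg (e + w.1.1) <= maxn (deg e) (deg w.1.1))%N by deg_tac.
      by rewrite S; dlia.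
    have De' : w'.1.1 = e by rewrite -Dw.
    have ra := ext_root_a tr; have rb := tripleT (triple_ext tr); have rc := ext_root_c tr.
    have q3 : congr c (2 * s * (r * s - a * t) * (c * r - s * t)) (a + e - b).
      by exists (1 + 2 * a * e); rewrite /e /ext; ring: Er Es Et.
    have q4 : congr c (2 * t * (r * t - b * s) * (c * r - s * t)) (b + e - a).
      by exists (1 + 2 * b * e); rewrite /e /ext; ring: Er Es Et.
    have [eA [HA PA FA]] := chain_formula Es hw Ew (X0 := r * s - a * t) (Z0 := c * r - s * t)
      ltac:(rewrite De ra.2 //) ltac:(rewrite De rc.2 //) q3.
    have [eB [HB PB FB]] := chain_formula Et hw' Ew' (X0 := r * t - b * s) (Z0 := c * r - s * t)
      ltac:(rewrite De' rb.2 //) ltac:(rewrite De' rc.2 //) q4.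
    have [k Ek] := signed_even eA On; have [l El] := signed_even eB Om.
    have [] := @chains_ext_ext a b c r s t e (eA * n%:Z) (eB * m%:Z) k l G erefl Ek El.
      apply: congr_trans (congr_trans (congr_sym _) FB) _; last by exists 0; rewrite De'; ring.
      by apply: congr_trans FA _; exists 0; rewrite De; ring.
    (* At position -2 the first step from [e] leads to [b], and the second is the regular one. *)
    move=> _ [M0|M2]; first by move: (signed_neq0 HA n0); rewrite M0.
    have [eA1 n2] : eA = -1 /\ n = 2%N by case: HA => EA; rewrite EA in M2; dlia.
    rewrite n2 /= in Ew.
    have Eb : (up a c s w).1.1 = b.
      rewrite /up /=; have -> : 2 * s * w.1.2 * w.2 = 2 * s * (w.1.2 * w.2) by ring.
      by rewrite PA eA1 De /e /ext; ring: Er Es Et.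
    have -> : d = (up a c s (up a c s w)).1.1 by rewrite -Ew.
    by apply: up_regular => //; apply: sol_up.
  - rewrite On in CC.
    (* The root [± 1] of the starting point 0 becomes [± s] after an odd number of steps, so the
       other chain starts at [a]. *)
    have zw : w.2 ^+ 2 = 1 by rewrite Ezw D0 mulr0 add0r.
    have dzw : deg w.2 = 0%N by have := deg_sqr w.2; rewrite zw deg1; dlia.
    have Zs : s * w.2 = w'.2 by apply: congr_eq CC; [deg_tac|dlia].
    have Da' : w'.1.1 = a.
      by apply: inj; rewrite -Ezw' -Zs exprMn zw Es; ring.
    have [eA [HA _ FA]] := chain_formula Es hw Ew (sol_zero hw D0).1 (sol_zero hw D0).2
      (congr_refl _ _).
    have [eB [HB _ FB]] := chain_formula Et hw' Ew' (X0 := r) (Z0 := s)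
      ltac:(rewrite Da' Er; ring) ltac:(rewrite Da' Es; ring) q2.
    have [k Ek] := signed_odd HA On; have [l El] := signed_even eB Om.
    exfalso; apply: (@chains_zero_a a b c r s t e (eA * n%:Z) (eB * m%:Z) k l G erefl Ek El).
      exact: signed_neq0.
    apply: congr_trans (congr_trans (congr_sym _) FB) _; last by exists 0; rewrite Da'; ring.
    by apply: congr_trans FA _; exists 0; rewrite D0; ring.
  - rewrite On in CC.
    have Zs : w.2 ^+ 2 = s ^+ 2 by rewrite Ezw Da Es; ring.
    (* The root [± s] of [a] becomes [± s^2], that is [± 1] modulo [c], so the other chain starts at
       0. *)
    have C2 : congr c w'.2 (s ^+ 2) \/ congr c w'.2 (- s ^+ 2).
      case: (sqrf_eq Zs) => Zs1; rewrite Zs1 in CC; [left|right].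
        by rewrite expr2; apply: congr_sym.
      by apply: congr_trans (congr_sym CC) _; exists 0; ring.
    have Z1 : w'.2 ^+ 2 = 1.
      have Cs := congr_sqr1 Es.
      case: C2 => C2.
        have -> : w'.2 = 1.
          by apply: (congr_eq _ _ (congr_trans C2 Cs)); rewrite ?deg1; dlia.
        by rewrite expr1n.
      have -> : w'.2 = -1.
        by apply: (congr_eq _ _ (congr_trans C2 (congrN Cs))); rewrite ?degN ?deg1; dlia.
      by rewrite sqrrN expr1n.
    have D0' : w'.1.1 = 0 by apply: inj; rewrite -Ezw' Z1; ring.
    have [eA [HA _ FA]] := chain_formula Es hw Ew (X0 := 0) (Z0 := s) (q := 0)
        ltac:(rewrite Da -expr2 a2; ring) ltac:(rewrite Da Es; ring) ltac:(exists 0; ring).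
    have [eB [HB _ FB]] := chain_formula Et hw' Ew' (sol_zero hw' D0').1 (sol_zero hw' D0').2
      (congr_refl _ _).
    exfalso; apply: (@chains_self_zero a b c r s t (eA * n%:Z) (eB * m%:Z) G a2).
    apply: congr_trans (congr_trans (congr_sym _) FB) _; last by exists 0; rewrite D0'; ring.
    by apply: congr_trans FA _; exists 0; rewrite Da; ring.
rewrite Om in CC.
have zw' : w'.2 ^+ 2 = 1 by rewrite Ezw' D0' mulr0 add0r.
have dzw' : deg w'.2 = 0%N by have := deg_sqr w'.2; rewrite zw' deg1; dlia.
case: sideA => [On|[On D0]|[On a2 Da X0]].
- rewrite (negPf On) in CC.
  have Zt : w.2 = t * w'.2 by apply: congr_eq CC; [dlia|deg_tac].
  have Db : w.1.1 = b.
    by apply: inj; rewrite -Ezw Zt exprMn zw' Et; ring.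
  have [eA [HA _ FA]] := chain_formula Es hw Ew (X0 := r) (Z0 := t)
    ltac:(rewrite Db Er; ring) ltac:(rewrite Db Et; ring) q1.
  have [eB [HB _ FB]] := chain_formula Et hw' Ew' (sol_zero hw' D0').1 (sol_zero hw' D0').2
    (congr_refl _ _).
  exfalso; apply: (@chains_b_zero a b c r s t e (eA * n%:Z) (eB * m%:Z) G erefl).
    exact: signed_neq0.
  apply: congr_trans (congr_sym _) _; first by move: FA; rewrite Db; apply.
  move: FB; rewrite D0' /= => FB; apply: congr_trans FB _.
  by exists 0; ring.
- rewrite On in CC.
  have zw : w.2 ^+ 2 = 1 by rewrite Ezw D0 mulr0 add0r.
  have dzw : deg w.2 = 0%N by have := deg_sqr w.2; rewrite zw deg1; dlia.
  have E1 : s * w.2 = t * w'.2 by apply: congr_eq CC; deg_tac.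
  have E2 : (s * w.2) ^+ 2 = (t * w'.2) ^+ 2 by rewrite E1.
  move/eqP: hab; case; apply: (mulIf hc); apply: (addIr 1).
  by rewrite -Es -Et; move: E2; rewrite !exprMn zw zw' !mulr1.
- rewrite On in CC.
  have Zs : w.2 ^+ 2 = s ^+ 2 by rewrite Ezw Da Es; ring.
  have Cs := congr_sqr1 Es.
  have C2 : congr c (t * w'.2) (s ^+ 2) \/ congr c (t * w'.2) (- s ^+ 2).
    case: (sqrf_eq Zs) => Zs1; rewrite Zs1 in CC; [left|right].
      by rewrite expr2; apply: congr_sym.
    by apply: congr_trans (congr_sym CC) _; exists 0; ring.
  have dtw : deg (t * w'.2) = deg t.
    by rewrite degM ?dzw' ?addn0 //; [apply: deg_gt0_neq0; dlia|apply: sqr_neq0 zw' (oner_neq0 _)].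
  exfalso; case: C2 => C2.
    have : t * w'.2 = 1 by apply: (congr_eq _ _ (congr_trans C2 Cs)); rewrite ?deg1; dlia.
    by move/(congr1 deg); rewrite dtw deg1; dlia.
  have : t * w'.2 = -1.
    by apply: (congr_eq _ _ (congr_trans C2 (congrN Cs))); rewrite ?degN ?deg1; dlia.
  by move/(congr1 deg); rewrite dtw degN deg1; dlia.
Qed.

(** * Quadruples over a triple with two largest elements *)

(** Roots are known only up to sign, and for identifying starting points their squares suffice. *)
Definition pm_congr (c p q : P) := congr c p q \/ congr c p (- q).

Lemma pm_refl c p : pm_congr c p p.
Proof. by left; apply: congr_refl. Qed.

Lemma pm_sym c p q : pm_congr c p q -> pm_congr c q p.
Proof.
case=> [h|/congrN h]; first by left; apply: congr_sym.
by right; apply: congr_sym; rewrite opprK in h.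
Qed.

Lemma pm_trans c q p r : pm_congr c p q -> pm_congr c q r -> pm_congr c p r.
Proof.
move=> [h|h] [H|H].
- by left; apply: congr_trans H.
- by right; apply: congr_trans H.
- by right; apply: congr_trans h (congrN H).
- by left; have := congr_trans h (congrN H); rewrite opprK.
Qed.

Lemma pmM c p q p' q' : pm_congr c p q -> pm_congr c p' q' -> pm_congr c (p * p') (q * q').
Proof.
move=> [h|h] [h'|h']; have H := congrM h h'.
- by left.
- by right; rewrite -mulrN.
- by right; rewrite -mulNr.
- by left; rewrite mulrNN in H.
Qed.

Lemma pm_sqr_eq c p q : p ^+ 2 = q ^+ 2 -> pm_congr c p q.
Proof. by case/sqrf_eq => ->; [apply: pm_refl|right; apply: congr_refl]. Qed.

Lemma pm_eq c p q : (deg p < deg c)%N -> (deg q < deg c)%N -> pm_congr c p q ->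
  p ^+ 2 = q ^+ 2.
Proof.
move=> hp hq [] /congr_eq; rewrite ?degN => /(_ hp hq) ->; by rewrite ?sqrrN.
Qed.

Lemma sol_one b c t w : sol b c w -> t ^+ 2 = b * c + 1 ->
  (w.1.1 - b - c) ^+ 2 = 4 * (b * c + 1) ->
  exists e : int, [/\ e = 1 \/ e = -1, w.1.1 = b + c + 2 * (e%:~R * t),
    w.1.2 ^+ 2 = (b + e%:~R * t) ^+ 2 & w.2 ^+ 2 = (c + e%:~R * t) ^+ 2].
Proof.
move=> [_ [_ Ey] [_ Ez]] Et; rewrite -Et.
have -> : 4 * t ^+ 2 = (2 * t) ^+ 2 by ring.
move/sqrf_eq => H.
have [e He Ee] : exists2 e : int, e = 1 \/ e = -1 & w.1.1 = b + c + 2 * (e%:~R * t).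
  case: H => H; [exists 1; first by left|exists (-1); first by right];
    by apply: (eq_lc (k := 1) H); ring.
have e2 : e%:~R ^+ 2 = 1 :> P by case: He => ->; ring.
by exists e; split=> //; rewrite ?Ey ?Ez Ee; ring: e2 Et.
Qed.

(** The starting point [b + c ± 2 t] is itself one step above 0, so the formula for the chain of 0
    applies with [m + 1] in place of [m]. *)
Lemma chain_from_one b c t w m v : (0 < deg c)%N -> t ^+ 2 = b * c + 1 -> sol b c w ->
  (w.1.1 - b - c) ^+ 2 = 4 * (b * c + 1) -> v = iter m (up b c t) w ->
  (deg c < deg (up b c t w).2)%N ->
  exists e : int, [/\ e = 1 \/ e = -1, w.1.1 = b + c + 2 * (e%:~R * t),
    w.1.2 * w.2 = e%:~R * ((b + e%:~R * t) * (c + e%:~R * t)) &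
    congr c v.1.1 (b * (e * (m%:Z + 1))%:~R ^+ 2 + 2 * (e * (m%:Z + 1))%:~R * t)].
Proof.
move=> dc Et hw H Ev dup; have [e [He Ee Ey Ez]] := sol_one hw Et H.
have e2 : e%:~R ^+ 2 = 1 :> P by case: He => ->; ring.
have q : congr c (2 * t * (b + e%:~R * t) * (c + e%:~R * t))
    (2 * (e%:~R * b + t)).
  exists (2 * t * (b + e%:~R * t) + 2 * b * (b * e%:~R + t)).
  by ring: Et e2.
have [Ey' Ez'] : (b + e%:~R * t) ^+ 2 = b * w.1.1 + 1 /\ (c + e%:~R * t) ^+ 2 = c * w.1.1 + 1.
  by rewrite Ee; split; ring: Et e2.
have [f [Hf Pf [k Ek]]] := chain_formula Et hw Ev Ey' Ez' q.
have fe : f = e.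
  (* With the opposite sign the step up would return to 0, where the root is [± 1], against the
     hypothesis on its degree. *)
  have [//|fe] : f = e \/ f = - e by clear -He Hf; lia.
  have hc : c + e%:~R * t != 0.
    apply/eqP => c0; have := sol_neq0 dc hw; move/eqP: Ez; rewrite c0 expr0n /=.
    by rewrite expf_eq0 /= => ->.
  have : (up b c t w).2 = t * w.2 + c * w.1.2 by [].
  case/sqrf_eq: Ez => Ez; rewrite Ez in Pf *.
    have -> : w.1.2 = - (e%:~R * (b + e%:~R * t)).
      by apply: (mulIf hc); rewrite Pf fe; ring.
    have -> : t * (c + e%:~R * t) + c * - (e%:~R * (b + e%:~R * t)) = e%:~R.
      by ring: Et e2.
    by move=> E; rewrite E degZ_int in dup; exfalso; move: dup; clear; lia.
  have -> : w.1.2 = e%:~R * (b + e%:~R * t).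
    apply: (mulIf hc); transitivity (- (w.1.2 * - (c + e%:~R * t))); first by ring.
    by rewrite Pf fe; ring.
  have -> : t * - (c + e%:~R * t) + c * (e%:~R * (b + e%:~R * t)) = - e%:~R.
    by ring: Et e2.
  by move=> E; rewrite E degN degZ_int in dup; exfalso; move: dup; clear; lia.
rewrite fe in Pf Ek; exists e; split=> //.
exists (1 + k); rewrite Ek Ee; ring: e2.
Qed.

Lemma descent_top a c s d x z : halfGauss a -> halfGauss c -> root_of s a c ->
  a != 0 -> (deg a <= deg c)%N -> (0 < deg c)%N -> sol a c (d, x, z) ->
  (deg c < deg z)%N ->
  exists x' n w, [/\ sol a c w, (d, x', z) = iter n (up a c s) w, (0 < n)%N
      & (deg c < deg (up a c s w).2)%N] /\
    [/\ w.1.1 != 0, (deg w.2 <= deg c)%N, (2 * deg w.2 = deg c + deg w.1.1)%N,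
        deg z = (deg w.2 + n * deg s)%N & deg (up a c s w).2 = (deg w.2 + deg s)%N].
Proof.
move=> ha hc hs a0 dac dc hv dz; have Es := hs.2; have [_ ds] := deg_s_gt0 Es a0 dc.
have [x' [n [w [_ hw Ew dw Hn]]]] :=
  @descent a c s (deg c) ha hc hs a0 dc dac ltac:(dlia) d x z hv.
have n0 : (0 < n)%N.
  by case: n Ew {Hn} => // Ew; move: dw; rewrite -[w]/(iter 0 (up a c s) w) -Ew leqNgt dz.
have [dup _] := Hn n0.
(* From 0 a single step only reaches [± s ± c], of degree at most [deg c]. *)
have D0 : w.1.1 != 0.
  apply/eqP => D0; have [_ [_ EX] [_ EZ]] := hw; move: EX EZ; rewrite D0 !mulr0 add0r => EX EZ.
  have dX := deg_sqr w.1.2; have dZ := deg_sqr w.2; rewrite EX deg1 in dX; rewrite EZ deg1 in dZ.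
  have : (deg (up a c s w).2 <= deg c)%N.
    have -> : (up a c s w).2 = s * w.2 + c * w.1.2 by [].
    by deg_tac.
  by move: dup; clear; lia.
have dZ : (2 * deg w.2 = deg c + deg w.1.1)%N.
  by have [_ _ [_ EZ]] := hw; apply: (deg_root EZ (deg_gt0_neq0 dc) D0).
exists x', n, w; split=> //; split=> //.
  have -> : z = (iter n (up a c s) w).2 by rewrite -Ew.
  exact: chain_deg.
rewrite -[up a c s w]/(iter 1 (up a c s) w) (@chain_deg a c s w 1) ?mul1n //.
Qed.

Lemma type_one_sym x y z : (z - x - y) ^+ 2 = 4 * (x * y + 1) ->
  (x - y - z) ^+ 2 = 4 * (y * z + 1) :> P.
Proof. by move=> E; apply: (eq_lc (k := 1) E); ring. Qed.

Lemma base_type b c t w : halfGauss b -> halfGauss c -> root_of t b c -> sol b c w ->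
  w.1.1 != 0 -> (deg w.1.1 <= deg c)%N -> deg b = deg c -> (0 < deg c)%N ->
  (w.1.1 - b - c) ^+ 2 = 4 * (b * c + 1) \/ w.1.1 ^+ 2 = -1 /\ c = 2 * w.1.1 - b.
Proof.
move=> hb hc ht [hD hY hZ] D0 dD dbc dc.
have tr : triple w.1.1 b c w.1.2 w.2 t by split=> //; apply: root_ofC.
have [I|II] := triple_type tr D0 ltac:(rewrite dbc //) dbc ltac:(rewrite dbc //).
  by left; apply: type_one_sym.
by right.
Qed.

Lemma chain_pm a c s w n v : s ^+ 2 = a * c + 1 -> sol a c w ->
  v = iter n (up a c s) w -> pm_congr c v.2 (if odd n then s * w.2 else w.2).
Proof. by move=> Es hw ->; left; have [_ _ h _] := chain_congr n Es hw. Qed.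

Lemma one_steps_solve (M N : int) : N <> 0 -> M ^+ 2 = N ^+ 2 -> M + N ^+ 2 + N = 0 ->
  M = -2 /\ N = -2.
Proof.
move=> N0 E1 E2; have EM : M = - (N * (N + 1)) by lia.
have /eqP : N ^+ 2 * ((N + 1) ^+ 2 - 1) = 0.
  by rewrite mulrBr mulr1 -{2}E1 EM; ring.
rewrite mulf_eq0 expf_eq0 /= subr_eq0 sqrf_eq1.
by case/or3P => /eqP h; [case: N0|rewrite (_ : N = 0) in N0 *; [case: N0|lia]|lia].
Qed.

(** Modulo [c], [t] is [- s] and [b] is [a - 2 s], with [deg s < deg c], so the formula for the (b,
    c)-chain reduces to an expression in [a] and [s]. The root [z] is [± 1] or [± s] modulo [c], so
    the (a, c)-chain starts at 0 or [a]. *)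
Lemma case_type_one a b c d r s t x y z : quad a b c d r s t x y z ->
  c = a + b + 2 * r -> s = a + r -> t = b + r ->
  (deg a < deg b)%N -> deg b = deg c -> (deg c < deg d)%N -> regular a b c d.
Proof.
move=> Q Ec Es0 Et0 dab dbc hcd.
have [tr hd hx hy hz [a0 b0 c0 d0] [hab hac hbc] [had hbd hcdn]] := Q.
have [gA gB gC [gr Er] [gs Es] [gt Et]] := tr.
have dz := deg_root hz.2 c0 d0.
have dr := deg_root Er a0 b0; have ds := deg_root Es a0 c0; have dt := deg_root Et b0 c0.
have solA : sol a c (d, x, z) by [].
have solB : sol b c (d, y, z) by [].
have [y' [m [w' [[hw' Ew' m0 dup'] [D0' dw' dD' dzt _]]]]] :=
  @descent_top b c t d y z gB gC (conj gt Et) b0 ltac:(dlia) ltac:(dlia) solB ltac:(dlia).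
have [I|[D2 IIc]] := base_type gB gC (conj gt Et) hw' D0' ltac:(dlia) dbc ltac:(dlia);
  last first.
  have dD := deg_sqrN1 D2.
  have : (2 : int)%:~R * b = 2 * w'.1.1 - a - 2 * r.
    by apply: (eq_lc2 (k := -1) (l := 1) Ec IIc); ring.
  by move/mul_int_deg_eq0 => /(_ ltac:(deg_tac)).
have [e [He De _ Fd]] := @chain_from_one b c t w' m _ ltac:(dlia) Et hw' I Ew' dup'.
set N := e * (m%:Z + 1) in Fd.
have N0 : N <> 0 by move: He; rewrite /N; clear; case=> ->; lia.
have st : t = c - s by rewrite Ec Es0 Et0; ring.
have tms : pm_congr c t s by right; exists 1; rewrite st; ring.
have ss : pm_congr c (s * s) 1 by left; rewrite -expr2; apply: congr_sqr1 Es.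
have Fd' : congr c d (a * N%:~R ^+ 2 - 2 * s * (N ^+ 2 + N)%:~R).
  apply: congr_trans Fd _; exists (N%:~R ^+ 2 + 2 * N%:~R).
  by rewrite st (_ : b = a + c - 2 * s); [ring|rewrite Ec Es0; ring].
have [x' [n [w [Hx' hw Ew dw Hn]]]] :=
  @descent a c s (deg c).-1 gA gC (conj gs Es) a0 ltac:(dlia) ltac:(dlia) ltac:(dlia) d x z solA.
have n0 : (0 < n)%N.
  case: n Ew {Hn} => // Ew; move: dw; rewrite -[w]/(iter 0 (up a c s) w) -Ew [(_, _, _).2]/=.
  by dlia.
have zc : pm_congr c z 1 \/ pm_congr c z s.
  have [_ _ [_ EZ']] := hw'.
  have zt : pm_congr c w'.2 t.
    have [e' [He' _ _ Ez]] := sol_one hw' Et I.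
    apply: pm_trans (pm_sqr_eq c Ez) _; case: He' => ->.
      by left; exists 1; ring.
    by right; exists 1; ring.
  have zts := pm_trans zt tms.
  have := chain_pm Et hw' Ew'; rewrite [(_, _, _).2]/=; case: (odd m) => Z.
    left; apply: pm_trans Z _; apply: pm_trans ss; exact: pmM.
  by right; apply: pm_trans zts.
have wc : pm_congr c w.2 1 \/ pm_congr c w.2 s.
  have := chain_pm Es hw Ew; rewrite [(_, _, _).2]/=; case: (odd n) => Z.
    have Z' : pm_congr c w.2 (s * z).
      apply: pm_sym; apply: pm_trans (pmM (pm_refl c s) Z) _.
      have -> : s * (s * w.2) = s * s * w.2 by ring.
      by rewrite -[X in pm_congr c _ X]mul1r; apply: pmM => //; apply: pm_refl.
    case: zc => zc; [right|left]; apply: pm_trans Z' _.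
      by rewrite -[X in pm_congr c _ X]mulr1; apply: pmM => //; apply: pm_refl.
    by apply: pm_trans ss; apply: pmM => //; apply: pm_refl.
  by case: zc => zc; [left|right]; apply: pm_trans (pm_sym Z) zc.
have [_ [hX EX] [_ EZ]] := hw.
have dwc : (deg w.2 < deg c)%N by dlia.
case: wc => wc.
  have Z1 : w.2 ^+ 2 = 1 ^+ 2 by apply: pm_eq wc; rewrite ?deg1; dlia.
  have D0 : w.1.1 = 0.
    by apply: (mulfI c0); apply: (addIr 1); rewrite -EZ Z1; ring.
  have [f [Hf Pf FA]] := chain_formula Es hw Ew (sol_zero hw D0).1 (sol_zero hw D0).2
    (congr_refl _ _).
  have FF := congr_trans (congr_sym FA) Fd'; set M := f * n%:Z in FF.
  have /congr_eq : congr c (a * M%:~R ^+ 2 + 2 * M%:~R * s)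
      (a * N%:~R ^+ 2 - 2 * s * (N ^+ 2 + N)%:~R).
    by apply: congr_trans FF; exists 0; rewrite D0; ring.
  move/(_ ltac:(deg_tac) ltac:(deg_tac)) => E.
  have E1 : (2 * (M + N ^+ 2 + N))%:~R * s = a * (N ^+ 2 - M ^+ 2)%:~R.
    by apply: (eq_lc (k := 1) E); ring.
  have E2 : 2 * (M + N ^+ 2 + N) = 0 by apply: (mul_int_deg_eq0 E1); deg_tac.
  have E3 : N ^+ 2 - M ^+ 2 = 0.
    by apply: (int_const_eq a0); rewrite -E1 E2; ring.
  have [M2 _] := @one_steps_solve M N N0 ltac:(dlia) ltac:(dlia).
  have [f1 n2] : f = -1 /\ n = 2%N.
    by move: Hf M2; rewrite /M; clear; case=> ->; lia.
  (* From 0 with sign -1 the first step gives [a + c - 2 s]. *)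
  have Eb : (up a c s w).1.1 = b.
    rewrite /up /=; have -> : 2 * s * w.1.2 * w.2 = 2 * s * (w.1.2 * w.2) by ring.
    by rewrite Pf f1 D0 Ec Es0; ring.
  have -> : d = (up a c s (up a c s w)).1.1 by rewrite n2 in Ew; rewrite -[RHS]/(iter 2 (up a c s) w).1.1 -Ew.
  by apply: up_regular => //; apply: sol_up.
have Z1 : w.2 ^+ 2 = s ^+ 2 by apply: pm_eq wc; dlia.
have Da : w.1.1 = a.
  by apply: (mulfI c0); apply: (addIr 1); rewrite -EZ Z1 Es; ring.
have da : deg a = 0%N.
  apply/eqP; rewrite eqn0Ngt; apply/negP => da.
  by apply: (no_self_extension da (y := w.1.2)); rewrite EX Da.
have E1 : a ^+ 2 + 1 = w.1.2 ^+ 2 by rewrite EX Da.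
case: (halfGauss_const_unit gA hX E1 da) => [E0|X0]; first by rewrite E0 eqxx in a0.
have a2 : a ^+ 2 = -1 by apply: (eq_lc (k := 1) E1); rewrite X0; ring.
have [f [Hf Pf FA]] := chain_formula Es hw Ew (X0 := 0) (Z0 := s) (q := 0)
  ltac:(rewrite Da -expr2 a2; ring) ltac:(rewrite Da Es; ring) ltac:(exists 0; ring).
have FF := congr_trans (congr_sym FA) Fd'; set M := f * n%:Z in FF.
have /congr_eq : congr c (a * M%:~R ^+ 2 + a)
    (a * N%:~R ^+ 2 - 2 * s * (N ^+ 2 + N)%:~R).
  by apply: congr_trans FF; exists 0; rewrite Da; ring.
move/(_ ltac:(deg_tac) ltac:(deg_tac)) => E.
have E2 : (2 * (N ^+ 2 + N))%:~R * s = a * (N ^+ 2 - M ^+ 2 - 1)%:~R.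
  by apply: (eq_lc (k := 1) E); ring.
have E3 : 2 * (N ^+ 2 + N) = 0 by apply: (mul_int_deg_eq0 E2); deg_tac.
have E4 : N ^+ 2 - M ^+ 2 - 1 = 0.
  by apply: (int_const_eq a0); rewrite -E2 E3; ring.
have M0 := signed_neq0 Hf n0; rewrite -/M in M0.
by move: N0 E3 E4 M0; clear; nia.
Qed.

Lemma sign_sqrf (p q : P) : p ^+ 2 = q ^+ 2 ->
  exists2 e : int, e = 1 \/ e = -1 & p = e%:~R * q.
Proof.
by case/sqrf_eq => ->; [exists 1; [left|ring]|exists (-1); [right|ring]].
Qed.

Lemma sign_mul (e f : int) : e = 1 \/ e = -1 -> f = 1 \/ f = -1 -> e * f = 1 \/ e * f = -1.
Proof. by case=> ->; case=> ->; [left|right|right|left]. Qed.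

(** Here [s^2 = (a r)^2] and [t^2 = (1 + a c)^2], so [t] is [± 1] modulo [c] and [deg t = 2 deg s].
    A step of the (b, c)-chain raises the degree as much as two steps of the (a, c)-chain, which
    ties [n] to [m]. *)
Lemma case_type_two a b c d r s t x y z : quad a b c d r s t x y z ->
  a ^+ 2 = -1 -> c = 2 * a - b -> (0 < deg b)%N -> deg b = deg c ->
  (deg c < deg d)%N -> regular a b c d.
Proof.
move=> Q a2 Ec db dbc hcd.
have [tr hd hx hy hz [a0 b0 c0 d0] [hab hac hbc] [had hbd hcdn]] := Q.
have [gA gB gC [gr Er] [gs Es] [gt Et]] := tr.
have da := deg_sqrN1 a2.
have dz := deg_root hz.2 c0 d0.
have dr := deg_root Er a0 b0; have ds := deg_root Es a0 c0; have dt := deg_root Et b0 c0.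
have solA : sol a c (d, x, z) by [].
have solB : sol b c (d, y, z) by [].
have Eb : b = 2 * a - c by rewrite Ec; ring.
have r2 : r ^+ 2 = - (1 + a * c) by rewrite Er Eb; ring: a2.
have [e1 He1 Ese] : exists2 e : int, e = 1 \/ e = -1 & s = e%:~R * (a * r).
  by apply: sign_sqrf; rewrite Es exprMn a2 r2; ring.
have [e2 He2 Ete] : exists2 e : int, e = 1 \/ e = -1 & t = e%:~R * (1 + a * c).
  by apply: sign_sqrf; rewrite Et Eb; ring: a2.
pose tau := - (e1 * e2).
have Htau : tau = 1 \/ tau = -1.
  by have := sign_mul He1 He2; rewrite /tau; clear; lia.
have Esrt : s * r * t = tau%:~R * a * (1 + a * c) ^+ 2.
  by rewrite Ese Ete /tau; transitivity (e1%:~R * e2%:~R * a * r ^+ 2 * (1 + a * c));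
    [ring|rewrite r2; ring].
have q1 : congr c (2 * s * r * t) (2 * tau%:~R * a).
  exists (2 * tau%:~R * a * (2 * a + a ^+ 2 * c)).
  transitivity (2 * (s * r * t)); first by ring.
  by rewrite Esrt; ring.
have q2 : congr c (2 * t * r * s) (2 * tau%:~R * a).
  by case: q1 => k Ek; exists k; rewrite -Ek; ring.
have t1 : pm_congr c t 1.
  by case: He2 => H; rewrite H in Ete; [left; exists a|right; exists (- a)]; rewrite Ete; ring.
have ss : pm_congr c (s * s) 1 by left; rewrite -expr2; apply: congr_sqr1 Es.
have [x' [n [w [[hw Ew n0 dup] [D0 dw dD dzs dus]]]]] :=
  @descent_top a c s d x z gA gC (conj gs Es) a0 ltac:(dlia) ltac:(dlia) solA ltac:(dlia).
have [y' [m [w' [[hw' Ew' m0 dup'] [D0' dw' dD' dzt dut]]]]] :=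
  @descent_top b c t d y z gB gC (conj gt Et) b0 ltac:(dlia) ltac:(dlia) solB ltac:(dlia).
have [hD [hX EX] [hZ EZ]] := hw; have [hD' [hY EY] [hZ' EZ']] := hw'.
have inj : forall u v : P, c * u + 1 = c * v + 1 -> u = v.
  by move=> u v /addIr /(mulfI c0).
have zt : pm_congr c z w'.2.
  have := chain_pm Et hw' Ew'; rewrite [(_, _, _).2]/=; case: (odd m) => // Z.
  by apply: pm_trans Z _; rewrite -[X in pm_congr c _ X]mul1r; apply: pmM => //; apply: pm_refl.
have zs := chain_pm Es hw Ew; rewrite [(_, _, _).2]/= in zs.
have not_s1 : ~ pm_congr c s 1.
  move=> H; have : s ^+ 2 = 1 ^+ 2 by apply: pm_eq H; rewrite ?deg1; dlia.
  by move/(congr1 deg); rewrite deg_sqr expr1n deg1; dlia.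
have sq_s : forall p : P, pm_congr c p s -> pm_congr c p 1 -> False.
  by move=> p h1 h2; apply: not_s1; apply: pm_trans (pm_sym h1) h2.
(* The (b, c)-chain starts at [a], or one step above 0. The degree of [z] gives [n] in each case,
   and the residue of [z] records which case it is. *)
have alt : (w'.1.1 = a /\ n = (2 * m).-1 /\ pm_congr c z s \/
    (exists N : int, N != 0 /\ congr c d (b * N%:~R ^+ 2 + 2 * N%:~R * t)) /\
    n = (2 * m)%N /\ pm_congr c z 1) /\ deg w.2 = deg c.
  have [I|[D2 IIc]] := base_type gB gC (conj gt Et) hw' D0' ltac:(dlia) dbc ltac:(dlia).
    have [e [He De _ Fd]] := @chain_from_one b c t w' m _ ltac:(dlia) Et hw' I Ew' dup'.
    have [e' [He' _ _ Ez]] := sol_one hw' Et I.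
    have w1 : pm_congr c w'.2 1.
      apply: pm_trans (pm_sqr_eq c Ez) _; apply: pm_trans t1.
      by case: He' => ->; [left; exists 1; ring|right; exists 1; ring].
    have dD2 : deg w'.1.1 = deg c.
      have Ed : w'.1.1 = 2 * a + (2 * e * e2)%:~R * (1 + a * c).
        by rewrite De Ete Eb; ring.
      have dac : deg (1 + a * c) = deg c.
        by rewrite degDr ?degM ?da // deg1; dlia.
      have e0 : 2 * e * e2 != 0 by clear -He He2; lia.
      rewrite Ed degDr deg_intM // dac //; deg_tac.
    have nm : n = (2 * m)%N.
      have E : (deg w.2 + n * deg s = deg s * 2 + m * (deg s * 2))%N by dlia.
      have l1 : (deg s < deg w.2 <= deg s * 2)%N by dlia.
      have s0 : (0 < deg s)%N by dlia.
      clear -E l1 s0; nia.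
    split; last by rewrite nm in dzs; clear -dzs dzt dD2 dD' dt ds da dbc; nia.
    right; split; last by split=> //; apply: pm_trans w1.
    exists (e * (m%:Z + 1)); split; last exact: Fd.
    by clear -He; lia.
  have Da : w'.1.1 = a.
    have : (2 : P) * (w'.1.1 - a) = 0 by apply: (eq_lc2 (k := 1) (l := -1) Ec IIc); ring.
    by move/eqP; rewrite mulf_eq0 (negPf (nat_neq0P 1)) /= subr_eq0 => /eqP.
  have E : (deg w.2 + n * deg s = deg s + m * (deg s * 2))%N.
    by rewrite Da in dD'; dlia.
  have l1 : (deg s < deg w.2 <= deg s * 2)%N by dlia.
  have s0 : (0 < deg s)%N by dlia.
  have nm : n = (2 * m).-1 by clear -E l1 s0 m0; nia.
  have dwc : deg w.2 = deg c.
    have En : (n.+1 * deg s = 2 * m * deg s)%N by rewrite nm prednK // muln_gt0.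
    by clear -E En ds da; lia.
  split=> //.
  left; split=> //; split=> //; apply: pm_trans zt _.
  by apply: pm_sqr_eq; rewrite EZ' Da Es; ring.
case: alt => alt dwc.
have dDc : deg w.1.1 = deg c by dlia.
have trD : triple a c w.1.1 s w.1.2 w.2 by [].
(* The rival starting point [a + c ± 2 s] has root [± s] modulo [c]; with the parity of [n] this
   contradicts the residue of [z]. *)
have Db : w.1.1 = b.
  have [I|[_ ->]] := triple_type trD a0 ltac:(dlia) ltac:(dlia) ltac:(dlia); last by rewrite Eb.
  have I' : (w.1.1 - a - c) ^+ 2 = 4 * (a * c + 1) by rewrite I.
  exfalso; have [e [He De _ Ez]] := sol_one hw Es I'.
  have ws : pm_congr c w.2 s.
    apply: pm_trans (pm_sqr_eq c Ez) _.
    by case: He => ->; [left; exists 1; ring|right; exists 1; ring].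
  case: alt => [[_ [nm zc]]|[_ [nm zc]]].
    have On : odd n by rewrite nm; case: m m0 {nm Ew' dzt} => // m _; rewrite mulnS /= oddM.
    rewrite On in zs; apply: (sq_s z zc); apply: pm_trans zs _.
    by apply: pm_trans ss; apply: pmM => //; apply: pm_refl.
  have On : odd n = false by rewrite nm oddM.
  by rewrite On in zs; apply: (sq_s z) => //; apply: pm_trans zs ws.
have [e [He Pe FA]] := chain_formula Es hw Ew (X0 := r) (Z0 := t)
  ltac:(rewrite Db Er; ring) ltac:(rewrite Db Et; ring) q1.
(* With the other sign the step up from [b] would lead to [a], whose root has degree [deg s], too
   small for [dup]. *)
have et : e * tau = 1.
  have [//|et] := sign_mul He Htau.
  have ua : (up a c s w).1.1 = a.
    have : 2 * s * w.1.2 * w.2 = - 2 * a * (1 + a * c) ^+ 2.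
      transitivity (2 * s * (w.1.2 * w.2)); first by ring.
      rewrite Pe; transitivity (2 * e%:~R * (s * r * t)); first by ring.
      rewrite Esrt; transitivity (2 * (e * tau)%:~R * a * (1 + a * c) ^+ 2); first by ring.
      by rewrite et; ring.
    by rewrite /up /= => ->; rewrite Db Eb; ring: a2.
  have [_ _ [_ Eu]] := sol_up gA gC (conj gs Es) hw.
  rewrite ua in Eu; have := deg_root Eu c0 a0.
  by move: dup ds da; clear; lia.
have FA' : congr c d (a * ((n%:Z + 1) ^+ 2 + 1)%:~R).
  apply: congr_trans FA _; exists (- 1); rewrite Db Eb.
  have E2 : e%:~R ^+ 2 = 1 :> P by case: He => ->; ring.
  have E3 : e%:~R * tau%:~R = 1 :> P by rewrite -rmorphM /= et.
  apply: (eq_lc2 (k := a * n%:R ^+ 2) (l := 2 * n%:R * a) E2 E3); ring.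
case: alt => [[Da [nm _]]|[[N [N0 FB]] _]]; last first.
  exfalso; move/eqP: N0; apply.
  have FF : congr c (a * ((n%:Z + 1) ^+ 2 + 1)%:~R) (a * (2 * N ^+ 2)%:~R + (2 * e2 * N)%:~R).
    apply: congr_trans (congr_trans (congr_sym FA') FB) _.
    by exists (- N%:~R ^+ 2 + 2 * N%:~R * e2%:~R * a); rewrite Ete Eb; ring.
  move/congr_eq: FF => /(_ ltac:(deg_tac) ltac:(deg_tac)) E.
  have [_ E4] : (n%:Z + 1) ^+ 2 + 1 - 2 * N ^+ 2 = 0 /\ 2 * e2 * N = 0.
    by apply: (sqr_sum_a a2); apply: (eq_lc (k := 1) E); ring.
  by case: He2 E4 => ->; clear; lia.
have [f [Hf _ FB]] := chain_formula Et hw' Ew' (X0 := r) (Z0 := s)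
  ltac:(rewrite Da Er; ring) ltac:(rewrite Da Es; ring) q2.
have FF : congr c (a * ((n%:Z + 1) ^+ 2 + 1)%:~R)
    (a * (2 * m%:Z ^+ 2 + 2 * f * tau * m%:Z + 1)%:~R).
  apply: congr_trans (congr_trans (congr_sym FA') FB) _.
  have E2 : f%:~R ^+ 2 = 1 :> P by case: Hf => ->; ring.
  exists (- m%:R ^+ 2); rewrite Da Eb.
  apply: (eq_lc (k := (2 * a - c) * m%:R ^+ 2) E2); ring.
move/congr_eq: FF => /(_ ltac:(deg_tac) ltac:(deg_tac)) E.
have E4 : (n%:Z + 1) ^+ 2 + 1 - (2 * m%:Z ^+ 2 + 2 * f * tau * m%:Z + 1) = 0.
  by apply: (int_const_eq a0); apply: (eq_lc (k := 1) E); ring.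
have n1 : n = 1%N.
  have En : n%:Z + 1 = 2 * m%:Z by rewrite nm; clear -m0; lia.
  have ft := sign_mul Hf Htau.
  rewrite En in E4; have {}E4 : m%:Z * (m%:Z - f * tau) = 0.
    by clear -E4; lia.
  by clear -E4 ft m0 En; nia.
rewrite n1 /= in Ew.
have -> : d = (up a c s w).1.1 by rewrite -Ew.
exact: up_regular.
Qed.

Lemma type_two_root_pm a c s k : s ^+ 2 = a * c + 1 -> k ^+ 2 = -1 ->
  c = 2 * k - a -> pm_congr c s 1.
Proof.
move=> Es k2 Ec; have : s ^+ 2 = (1 + k * c) ^+ 2.
  by rewrite Es (_ : a = 2 * k - c); [ring: k2|rewrite Ec; ring].
case/sqrf_eq => ->; [left; exists k|right; exists (- k)]; ring.
Qed.

(** Since [s] and [t] have degree [deg c], both chains take the same number of steps, but the final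
    congruence cannot be read as an equality. Instead [c] divides [2 (M + N^2 + N) s], and [s] is
    invertible modulo [c]. *)
Lemma case_equal a b c d r s t x y z : quad a b c d r s t x y z ->
  c = a + b + 2 * r -> s = a + r -> t = b + r ->
  deg a = deg b -> deg b = deg c -> (0 < deg c)%N -> (deg c < deg d)%N ->
  (forall D X Y Z, quad a b c D r s t X Y Z -> (deg D < deg c)%N -> regular a b c D) ->
  regular a b c d.
Proof.
move=> Q Ec Es0 Et0 dab dbc dc hcd IH.
have [tr hd hx hy hz [a0 b0 c0 d0] [hab hac hbc] [had hbd hcdn]] := Q.
have [gA gB gC [gr Er] [gs Es] [gt Et]] := tr.
have dz := deg_root hz.2 c0 d0.
have dr := deg_root Er a0 b0; have ds := deg_root Es a0 c0; have dt := deg_root Et b0 c0.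
have solA : sol a c (d, x, z) by [].
have solB : sol b c (d, y, z) by [].
have [x' [n [w [[hw Ew n0 dup] [D0 dw dD dzs dus]]]]] :=
  @descent_top a c s d x z gA gC (conj gs Es) a0 ltac:(dlia) ltac:(dlia) solA ltac:(dlia).
have [y' [m [w' [[hw' Ew' m0 dup'] [D0' dw' dD' dzt dut]]]]] :=
  @descent_top b c t d y z gB gC (conj gt Et) b0 ltac:(dlia) ltac:(dlia) solB ltac:(dlia).
have [hD hX [hZ EZ]] := hw; have [hD' hY [hZ' EZ']] := hw'.
have nm : n = m.
  have E : (deg w.2 + n * deg c = deg w'.2 + m * deg c)%N.
    have [Ea Eb] : deg s = deg c /\ deg t = deg c by split; dlia.
    by rewrite -{1}Ea -{1}Eb -dzs.
  have l1 : (0 < deg w.2 <= deg c)%N by dlia.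
  have l2 : (0 < deg w'.2 <= deg c)%N by dlia.
  by clear -E l1 l2; nia.
have dww : deg w.2 = deg w'.2.
  have [Ea Eb] : deg s = deg c /\ deg t = deg c by split; dlia.
  by rewrite Ea nm in dzs; rewrite Eb in dzt; clear -dzs dzt; lia.
have st : t = c - s by rewrite Ec Es0 Et0; ring.
have ts : pm_congr c t s by right; exists 1; rewrite st; ring.
have typeA := base_type gA gC (conj gs Es) hw D0 ltac:(dlia) ltac:(dlia) dc.
have typeB := base_type gB gC (conj gt Et) hw' D0' ltac:(dlia) ltac:(dlia) dc.
(* If [s] is [± 1] modulo [c], the starting points agree and, by induction, are a regular extension.
   As [c = a + b + 2 r], one of the two extensions is 0 and the other has degree
   [deg a + deg b + deg c], too large. *)
have unit_case : pm_congr c s 1 -> (deg w.2 < deg c)%N -> regular a b c d.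
  move=> s1 dwc; exfalso; have t1 := pm_trans ts s1.
  have red : forall (u p : P) k, pm_congr c u 1 -> pm_congr c (if odd k then u * p else p) p.
    move=> u p k hu; case: (odd k); last exact: pm_refl.
    by rewrite -[X in pm_congr c _ X]mul1r; apply: pmM => //; apply: pm_refl.
  have zs := pm_trans (chain_pm Es hw Ew) (red s w.2 n s1).
  have zt := pm_trans (chain_pm Et hw' Ew') (red t w'.2 m t1).
  have Ew2 : w.2 ^+ 2 = w'.2 ^+ 2.
    by apply: pm_eq (pm_trans (pm_sym zs) zt) => //; rewrite -dww.
  have Dw : w.1.1 = w'.1.1.
    by apply: (mulfI c0); apply: (addIr 1); rewrite -EZ Ew2 EZ'.
  have dk : (deg w.1.1 < deg c)%N by dlia.
  have neq : forall p : P, deg p = deg c -> p != w.1.1.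
    by move=> p dp; apply/eqP => E; move: dk; rewrite -E dp ltnn.
  have QD : quad a b c w.1.1 r s t w.1.2 w'.1.2 w.2.
    by split=> //; [rewrite Dw|split; apply: neq; dlia].
  have [t' tr' [ED _]] := regular_ext tr (IH _ _ _ _ QD dk).
  have M := ext_mul tr'; have S := @deg_ext_add a b c r s t' a0 b0 ltac:(dlia) ltac:(dlia) dc ltac:(dlia).
  move/eqP: M; rewrite -ED (_ : (c - (a + b)) ^+ 2 - 4 * r ^+ 2 = 0); last by rewrite Ec; ring.
  rewrite mulf_eq0 (negPf D0) /= => /eqP E0.
  by move: S; rewrite E0 addr0 -ED; dlia.
case: typeA => [IA|[k2 Ek]]; last first.
  apply: unit_case; first exact: type_two_root_pm Es k2 Ek.
  by have := deg_sqrN1 k2; dlia.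
case: typeB => [IB|[k2 Ek]]; last first.
  apply: unit_case.
    by apply: pm_trans (pm_sym ts) _; apply: type_two_root_pm Et k2 Ek.
  by have := deg_sqrN1 k2; dlia.
have [e [He De Pe FA]] := @chain_from_one a c s w n _ dc Es hw IA Ew dup.
have [f [Hf _ _ FB]] := @chain_from_one b c t w' m _ dc Et hw' IB Ew' dup'.
set M := e * _ in FA; set N := f * _ in FB.
have N0 : N <> 0 by clear -Hf; rewrite /N; lia.
have MN : M ^+ 2 = N ^+ 2 by rewrite /M /N nm; clear -He Hf; case: He Hf => -> [] ->; ring.
have Eb : b = a + c - 2 * s by rewrite Ec Es0; ring.
have K : congr c ((2 * (M + N ^+ 2 + N))%:~R * s) 0.
  have [k Ek] := congr_trans (congr_sym FA) FB.
  exists (k + N%:~R ^+ 2 + 2 * N%:~R).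
  have MN' : M%:~R ^+ 2 = N%:~R ^+ 2 :> P by rewrite -!rmorphXn /= MN.
  apply: (eq_lc2 (k := 1) (l := - a) Ek MN'); rewrite Eb st; ring.
have E2 : M + N ^+ 2 + N = 0.
  have [//|H] : M + N ^+ 2 + N = 0 \/ 2 * (M + N ^+ 2 + N) <> 0 by clear; lia.
  case: K => k; rewrite add0r => Ek; exfalso.
  have Es' : s ^+ 2 = c * a + 1 by rewrite Es; ring.
  by apply: (not_dvd_root dc _ Es' Ek); apply/eqP.
have [M2 _] := one_steps_solve N0 MN E2.
have [e1 n1] : e = -1 /\ n = 1%N by move: He M2 n0; rewrite /M; clear; case=> ->; lia.
rewrite n1 /= in Ew.
have -> : d = (up a c s w).1.1 by rewrite -Ew.
by apply: up_regular => //; rewrite De e1 Eb; ring.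
Qed.

(** By [triple_type], triples whose two largest elements have equal degree satisfy explicit
    relations, and those of different triples contradict each other. *)
Lemma case_top_equal a b c d r s t x y z : quad a b c d r s t x y z ->
  (deg a <= deg b)%N -> (deg b <= deg c)%N -> deg c = deg d -> (0 < deg b)%N -> False.
Proof.
move=> Q hab1 hbc1 hcd1 db.
have [tr hd hx hy hz [a0 b0 c0 d0] [hab hac hbc] [had hbd hcdn]] := Q.
have [gA gB gC hr hs ht] := tr.
have dr := deg_root hr.2 a0 b0; have ds := deg_root hs.2 a0 c0; have dt := deg_root ht.2 b0 c0.
have trA : triple a c d s x z by [].
have trB : triple b c d t y z by [].
have root1 : forall r' : P, r' = r \/ r' = - r -> r' ^+ 2 = a * b + 1.
  by move=> r' [] ->; rewrite ?sqrrN hr.2.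
have [hlt|heq] : (deg b < deg c)%N \/ deg b = deg c by clear -hbc1; lia.
  have [IB|[b2 _]] := triple_type trB b0 ltac:(dlia) hcd1 ltac:(dlia); last first.
    by have := deg_sqrN1 b2; dlia.
  have [t' Ht' Ed] := type_one_root ht.2 IB.
  have dt' : deg t' = deg t by case: Ht' => ->; rewrite ?degN.
  have Et' : t' ^+ 2 = b * c + 1 by case: Ht' => ->; rewrite ?sqrrN ht.2.
  have [IA|[a2 Ed2]] := triple_type trA a0 ltac:(dlia) hcd1 ltac:(dlia); last first.
    have : (2 : int)%:~R * c = 2 * a - b - 2 * t'.
      by apply: (eq_lc2 (k := -1) (l := 1) Ed Ed2); ring.
    by move/mul_int_deg_eq0 => /(_ ltac:(deg_tac)).
  have [s' Hs' Ed3] := type_one_root hs.2 IA.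
  have ds' : deg s' = deg s by case: Hs' => ->; rewrite ?degN.
  have Es' : s' ^+ 2 = a * c + 1 by case: Hs' => ->; rewrite ?sqrrN hs.2.
  have E1 : a - b = 2 * (t' - s') by apply: (eq_lc2 (k := -1) (l := 1) Ed3 Ed); ring.
  have : (a - b) * (s' + t' + 2 * c) = 0.
    have -> : (a - b) * (s' + t' + 2 * c) = (a - b) * (s' + t') + 2 * (a * c - b * c) by ring.
    rewrite {1}E1; apply: (eq_lc2 (k := -2) (l := 2) Es' Et'); ring.
  move/eqP; rewrite mulf_eq0 subr_eq0 (negPf hab) /= => /eqP E2.
  have : (2 : int)%:~R * c = - s' - t' by apply: (eq_lc (k := 1) E2); ring.
  by move/mul_int_deg_eq0 => /(_ ltac:(deg_tac)).
have trC : triple a b d r x y by [].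
(* If {a, c', 2 a - b} also has the first type, then [b + r'] and [a + r'] agree up to sign, so
   [a = b] or [c' = 0]. *)
have mirror : forall c' r', r' ^+ 2 = a * b + 1 -> c' = a + b + 2 * r' -> c' != 0 ->
    (2 * a - b - c' - a) ^+ 2 = 4 * (a * c' + 1) -> False.
  move=> c' r' Er' Ec' c'0 E.
  have : (b + r') ^+ 2 = (a + r') ^+ 2.
    have : 4 * (b + r') ^+ 2 = 4 * (a + r') ^+ 2.
      by apply: (eq_lc2 (k := 1) (l := 4 * a) E Er'); rewrite Ec'; ring: Er'.
    by apply: mulfI; apply: (nat_neq0P 3).
  case/sqrf_eq => E1; move/eqP: hab; first by apply; apply/esym; apply: (addIr r').
  by move=> _; move/eqP: c'0; apply; rewrite Ec'; apply: (eq_lc (k := 1) E1); ring.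
have I3 := triple_type trA a0 ltac:(dlia) hcd1 ltac:(dlia).
have [I1|[a2 Ec]] := triple_type tr a0 hab1 heq db; last first.
  have [I2|[_ Ed]] := triple_type trC a0 hab1 ltac:(dlia) db.
    have [r' Hr' Ed] := type_one_root hr.2 I2; have Er' := root1 _ Hr'.
    case: I3 => [I3|[_ Ed']]; last first.
      by move/eqP: hbd; apply; rewrite Ed' Ec; ring.
    apply: (mirror d r' Er' Ed d0).
    by rewrite -Ec; apply: (eq_lc (k := 1) I3); ring.
  by move/eqP: hcdn; apply; rewrite Ec Ed.
have [r' Hr' Ec] := type_one_root hr.2 I1; have Er' := root1 _ Hr'.
have [I2|[_ Ed]] := triple_type trC a0 hab1 ltac:(dlia) db; last first.
  case: I3 => [I3|[_ Ed']]; last first.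
    by move/eqP: hbc; apply; apply: (eq_lc2 (k := -1) (l := 1) Ed' Ed); ring.
  by apply: (mirror c r' Er' Ec c0); rewrite Ed in I3; apply: (eq_lc (k := 1) I3); ring.
have [r2 Hr2 Ed] := type_one_root hr.2 I2.
have [E|E] : r2 = r' \/ r2 = - r'.
  by case: Hr' => ->; case: Hr2 => ->; rewrite ?opprK; [left|right|right|left].
  by move/eqP: hcdn; apply; rewrite Ec Ed E.
rewrite {}E in Ed; case: I3 => [I3|[_ Ed']]; last first.
  have : 2 * b = 0 by apply: (eq_lc2 (k := 1) (l := 1) Ed' (esym Ed)); rewrite ?Ec; ring.
  by move/eqP; rewrite mulf_eq0 (negPf b0) (negPf (nat_neq0P 1)).
(* What remains is [c = a + b + 2 r'] and [d = a + b - 2 r']; this factorisation of 4 makes [a] and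
   [b] constant. *)
have E : a * (a - 4 * b) = 4.
  have : 3 * (a * (a - 4 * b)) = 3 * 4.
    apply: (eq_lc2 (k := - 1) (l := 12) I3 Er'); rewrite Ed Ec; ring: Er'.
  by apply: mulfI; apply: (nat_neq0P 2).
have [da d4] := @mul_const a (a - 4 * b) ltac:(rewrite E (nat_neq0P 3) //) ltac:(rewrite E degZ_nat //).
have : deg ((4 : nat)%:R * b) = 0%N.
  move: d4; set u := a - 4 * b => d4.
  have -> : (4 : nat)%:R * b = a - u by rewrite /u; ring.
  by apply/eqP; rewrite -leqn0; deg_tac.
by rewrite deg_natM //; dlia.
Qed.

(** * The general case *)

Definition dio_set (S : seq P) : Prop :=
  [/\ uniq S, 0 \notin S, {in S, forall p, halfGauss p}
    & {in S &, forall p q, p != q -> exists r, root_of r p q}].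

(** The relation of [regular_sums] written with power sums, so that it survives sorting by
    degree. *)
Definition regular_seq (S : seq P) : Prop :=
  2 * \sum_(p <- S) p ^+ 2 = (\sum_(p <- S) p) ^+ 2 + 4 * \prod_(p <- S) p + 4.

Lemma regular_seqE a b c d : regular_seq [:: a; b; c; d] <-> regular a b c d.
Proof.
rewrite regular_sums /regular_seq !big_cons !big_nil.
by split=> E; apply: (eq_lc (k := 1) E); ring.
Qed.

Lemma perm_dio_set S T : perm_eq S T -> dio_set S -> dio_set T.
Proof.
move=> eST [h1 h2 h3 h4]; have m := perm_mem eST; split.
- by rewrite -(perm_uniq eST).
- by rewrite -m.
- by move=> p; rewrite -m; apply: h3.
- by move=> p q; rewrite -!m; apply: h4.
Qed.

Lemma perm_regular_seq S T : perm_eq S T -> regular_seq S -> regular_seq T.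
Proof. by move=> eST; rewrite /regular_seq !(perm_big _ eST). Qed.

Lemma dio_set_quad a b c d : dio_set [:: a; b; c; d] ->
  exists r s t x y z, quad a b c d r s t x y z.
Proof.
case; rewrite /= !inE !negb_or => /and4P[/and3P[ab ac ad] /andP[bc bd] cd _].
rewrite ![0 == _]eq_sym => /and4P[a0 b0 c0 d0] hG hR.
have R : forall p q, p \in [:: a; b; c; d] -> q \in [:: a; b; c; d] -> p != q ->
  exists r, root_of r p q by exact: hR.
have [r Hr] := R a b ltac:(rewrite !inE eqxx ?orbT //) ltac:(rewrite !inE eqxx ?orbT //) ab.
have [s Hs] := R a c ltac:(rewrite !inE eqxx ?orbT //) ltac:(rewrite !inE eqxx ?orbT //) ac.
have [t Ht] := R b c ltac:(rewrite !inE eqxx ?orbT //) ltac:(rewrite !inE eqxx ?orbT //) bc.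
have [x Hx] := R a d ltac:(rewrite !inE eqxx ?orbT //) ltac:(rewrite !inE eqxx ?orbT //) ad.
have [y Hy] := R b d ltac:(rewrite !inE eqxx ?orbT //) ltac:(rewrite !inE eqxx ?orbT //) bd.
have [z Hz] := R c d ltac:(rewrite !inE eqxx ?orbT //) ltac:(rewrite !inE eqxx ?orbT //) cd.
have G : forall p, p \in [:: a; b; c; d] -> halfGauss p by exact: hG.
exists r, s, t, x, y, z; split=> //; last by apply: G; rewrite !inE eqxx ?orbT.
by split=> //; apply: G; rewrite !inE eqxx ?orbT.
Qed.

Lemma quad_dio_set a b c d r s t x y z : quad a b c d r s t x y z ->
  dio_set [:: a; b; c; d].
Proof.
case=> [[ga gb gc hr hs ht]] gd hx hy hz [a0 b0 c0 d0] [ab ac bc] [ad bd cd]; split.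
- by rewrite /= !inE !negb_or ab ac ad bc bd cd.
- by rewrite !inE !negb_or ![0 == _]eq_sym a0 b0 c0 d0.
- by move=> p; rewrite !inE => /or4P[] /eqP ->.
- move=> p q; rewrite !inE => /or4P[] /eqP -> /or4P[] /eqP ->; rewrite ?eqxx // => _.
  all: by [exists r|exists s|exists t|exists x|exists y|exists z|exists r; apply: root_ofC
    |exists s; apply: root_ofC|exists t; apply: root_ofC|exists x; apply: root_ofC
    |exists y; apply: root_ofC|exists z; apply: root_ofC].
Qed.

Lemma quad_change_st a b c d r s t x y z r' s' t' : quad a b c d r s t x y z ->
  r' ^+ 2 = r ^+ 2 -> s' ^+ 2 = s ^+ 2 -> t' ^+ 2 = t ^+ 2 -> quad a b c d r' s' t' x y z.
Proof.
have H : forall u v p q, u ^+ 2 = v ^+ 2 -> root_of v p q -> root_of u p q.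
  by move=> u v p q /sqrf_eq[] -> // h; apply: root_ofN.
by case=> [[ga gb gc hr hs ht]] *; split=> //; split=> //; apply: H; eassumption.
Qed.

(** Induction on a bound for the degrees: replacing [d] by [D] of degree below [deg c] lowers the
    largest degree from [deg d] to [deg c]. *)
Lemma dio_set_regular n S : size S = 4%N -> dio_set S -> has (fun p => 0 < deg p)%N S ->
  all (fun p => deg p <= n)%N S -> regular_seq S.
Proof.
elim/ltn_ind: n S => n IH S.
pose le (p q : P) := (deg p <= deg q)%N.
have eS : perm_eq S (sort le S) by rewrite perm_sym; apply/permPl; apply: perm_sort.
have sS : sorted le (sort le S) by apply: sort_sorted => p q; apply: leq_total.
rewrite -(size_sort le) => sz dS hS aS.
have {dS} dS := perm_dio_set eS dS.
rewrite (perm_has _ eS) in hS; rewrite (perm_all _ eS) in aS.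
suff R : regular_seq (sort le S) by apply: perm_regular_seq R; rewrite perm_sym.
case: (sort le S) sz dS sS hS aS => [|a [|b [|c [|d [|]]]]] //= _ dS {eS}.
rewrite /le !andbT !orbF => /and3P[h1 h2 h3] hS /and4P[_ _ _ hn].
have [r [s [t [x [y [z Q]]]]]] := dio_set_quad dS.
have [tr hd hx hy hz [a0 b0 c0 d0] [hab hac hbc] [had hbd hcdn]] := Q.
apply/regular_seqE.
have dd : (0 < deg d)%N by move: hS h1 h2 h3; clear; lia.
(* Otherwise [a] and [b] would be two constants extending the nonconstant [d]. *)
have db : (0 < deg b)%N.
  rewrite lt0n; apply/eqP => db; move/eqP: hab; apply.
  by apply: (@two_const a b d x y) => //; [move: h1; rewrite db; clear; lia|exact: hx.2|exact: hy.2].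
have [hcd|hcd] : (deg c < deg d)%N \/ deg c = deg d by move: h3; clear; lia.
  have IH' : forall r s t D X Y Z, quad a b c D r s t X Y Z -> (deg D < deg c)%N ->
      regular a b c D.
    move=> r0 s0 t0 D X Y Z QD dD; apply/regular_seqE; apply: (IH (deg c)) => //.
    - exact: leq_trans hcd hn.
    - exact: quad_dio_set QD.
    - by rewrite /= db orbT.
    - by rewrite /= leqnn (leq_trans h1 h2) h2 (ltnW dD).
  have [hbc1|hbc1] : (deg b < deg c)%N \/ deg b = deg c by move: h2; clear; lia.
    have [t' Ht' [e0 de]] := small_ext_exists tr a0 b0 h1 hbc1 db.
    have Q' : quad a b c d r s t' x y z.
      by apply: quad_change_st Q _ _ _ => //; case: Ht' => ->; rewrite ?sqrrN.
    have G : gap a b c r s t' by split=> //; case: Q'.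
    by apply: case_gap G Q' hcd _ => D X Y Z; apply: IH'.
  have [I|[a2 Ec]] := triple_type tr a0 h1 hbc1 db; last first.
    exact: case_type_two Q a2 Ec db hbc1 hcd.
  have [r' Hr' Ec] := type_one_root (tripleR tr).2 I.
  have Er' : r' ^+ 2 = r ^+ 2 by case: Hr' => ->; rewrite ?sqrrN.
  have Er2 := (tripleR tr).2.
  have Q' : quad a b c d r' (a + r') (b + r') x y z.
    apply: (quad_change_st Q Er').
      by rewrite (tripleS tr).2 Ec; ring: Er' Er2.
    by rewrite (tripleT tr).2 Ec; ring: Er' Er2.
  have [hab1|hab1] : (deg a < deg b)%N \/ deg a = deg b by move: h1; clear; lia.
    exact: case_type_one Q' Ec erefl erefl hab1 hbc1 hcd.
  have dc : (0 < deg c)%N by rewrite -hbc1.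
  by apply: case_equal Q' Ec erefl erefl hab1 hbc1 dc hcd _ => D X Y Z; apply: IH'.
by case: (case_top_equal Q h1 h2 hcd db).
Qed.

Definition half (p : {poly gaussInt}) : P := (2^-1)%:P * map_poly \val p.

Lemma two_half p : 2 * half p = map_poly \val p.
Proof.
rewrite /half mulrA -[2](rmorph_nat (@polyC algC)) -polyCM mulfV ?mul1r //.
by rewrite pnatr_eq0.
Qed.

Lemma half_halfGauss p : halfGauss (half p).
Proof.
move=> n; rewrite two_half.
have -> : n%:R = \val (n%:R : gaussInt) by rewrite rmorph_nat.
by rewrite horner_map; apply: gvalP.
Qed.

Lemma half_inj : injective half.
Proof.
move=> p q E; have : map_poly \val p = map_poly \val q by rewrite -!two_half E.
by apply: map_inj_poly; [exact: val_inj|exact: rmorph0].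
Qed.

Lemma half_root p q : is_square (p * q + 4) -> exists r, root_of r (half p) (half q).
Proof.
case=> r E; exists (half r); split; first exact: half_halfGauss.
have n4 : (4 : P) != 0 by apply: (nat_neq0P 3).
apply: (mulfI n4); have : map_poly \val (p * q + 4) = map_poly \val (r ^+ 2) :> P by rewrite E.
rewrite rmorphD rmorphM rmorphXn rmorph_nat /= -!two_half => E1.
by apply: (eq_lc (k := - 1) E1); ring.
Qed.

Theorem theorem1p6 (a b c d : {poly gaussInt}) :
  D4_quadruple a b c d -> regular_quadruple a b c d.
Proof.
case=> uS S0 nc hS; pose S := [seq half p | p <- [:: a; b; c; d]].
have half0 : half 0 = 0 by rewrite /half rmorph0 mulr0.
have dS : dio_set S.
  split.
  - by rewrite map_inj_uniq //; apply: half_inj.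
  - by rewrite -half0 mem_map //; apply: half_inj.
  - by move=> _ /mapP[p _ ->]; apply: half_halfGauss.
  - move=> _ _ /mapP[p hp ->] /mapP[q hq ->] hpq; apply: half_root; apply: hS => //.
    by apply: contraNneq hpq => ->.
have degE p : deg (half p) = (size p).-1.
  by rewrite -(@deg_natM 2) // two_half /deg size_map_inj_poly //; exact: val_inj.
have hd : has (fun p => 0 < deg p)%N S.
  have [p hp np] := allPn nc; apply/hasP; exists (half p).
    exact: map_f.
  by rewrite degE; move: np; clear; lia.
have : regular_seq S.
  apply: (@dio_set_regular (\max_(p <- S) deg p)) => //.
  by apply/allP => p hp; apply: leq_bigmax_seq.
rewrite regular_seqE => /regular_sums E.
(* In terms of the halved elements this is 4 times the symmetric relation. *)
have F : map_poly \val ((a + b - c - d) ^+ 2) = map_poly \val ((a * b + 4) * (c * d + 4)) :> P.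
  rewrite rmorphXn rmorphM !rmorphB !rmorphD !rmorphM !rmorph1 /= -!two_half.
  by apply: (eq_lc (k := 4) E); ring.
by apply: (map_inj_poly val_inj (rmorph0 _) F).
Qed.
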